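(* The following language inclusion problem is undecidable: given a timed visibly one-counter net $\mathcal{A}$ and a timed automaton $\mathcal{B}$ over a common finite alphabet $\Sigma$, decide whether $L(\mathcal{A})\subseteq L(\mathcal{B})$. This holds even if the inputs are restricted so that $\mathcal{A}$ is deterministic and has no clocks, and $\mathcal{B}$ uses at most one clock.
   Context: **Timed words.** Let $\Sigma$ be a finite alphabet. A timed word over $\Sigma$ is a non-empty finite sequence $(a_1,t_1)\dots(a_n,t_n)\in(\Sigma\times\mathbb{R}_{\ge 0})^+$ with $t_1\le\dots\le t_n$; $T\Sigma^+$ is the set of all timed words over $\Sigma$. **Clocks.** For a finite set $\mathcal{X}$ of clock variables, $\Phi(\mathcal{X})$ is the set of clock constraints, i.e. conjunctions of formulas $x\sim c$ with $x\in\mathcal{X}$, $c\in\mathbb{N}$, $\sim\in\{<,\le,=,\ge,>\}$; $\mathtt{true}$ denotes an always satisfied constraint, and $\Phi(\emptyset)=\{\mathtt{true}\}$. A clock valuation is a map $\nu:\mathcal{X}\to\mathbb{R}_{\ge0}$; $\nu\models\phi$ means $\phi$ is true under $\nu$; $(\nu+\delta)(x)=\nu(x)+\delta$; $\nu[\lambda:=0]$ sets the clocks in $\lambda\subseteq\mathcal{X}$ to $0$ and leaves the others unchanged. **Timed one-counter automata and nets.** A timed one-counter automaton is a tuple $(\Sigma,\mathcal{L},\mathcal{L}_0,\mathcal{L}_f,\mathcal{X},E)$ with a finite set $\mathcal{L}$ of locations, initial locations $\mathcal{L}_0\subseteq\mathcal{L}$, accepting locations $\mathcal{L}_f\subseteq\mathcal{L}$,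 a finite set of clocks $\mathcal{X}$, and a finite set of edges $E\subseteq\mathcal{L}\times\Sigma\times\Phi(\mathcal{X})\times\{push,pop,noop,empty?\}\times2^{\mathcal{X}}\times\mathcal{L}$ (it is a timed pushdown automaton with a one-letter stack alphabet, whose stack content is identified with its height). A state is $(l,\nu,m)$ with $l\in\mathcal{L}$, $\nu$ a clock valuation, $m\in\mathbb{N}$. There is a transition from $(l,\nu,m)$ to $(l',\nu',m')$ with delay $\delta\in\mathbb{R}_{\ge0}$ and letter $a$ iff there is an edge $(l,a,\phi,op,\lambda,l')\in E$ with $\nu+\delta\models\phi$, $\nu'=(\nu+\delta)[\lambda:=0]$, and: $m'=m+1$ if $op=push$; $m\geq 1$ and $m'=m-1$ if $op=pop$ (so $pop$ is blocked when $m=0$); $m'=m$ if $op=noop$; $m=m'=0$ if $op=empty?$. A run is a finite sequence of consecutive transitions; it is successful if it starts in a state $(l_0,\nu_0,0)$ with $l_0\in\mathcal{L}_0$ and all clocks $0$, and ends in a location in $\mathcal{L}_f$. A run with letters $a_1,\dots,a_n$ and delays $\delta_1,\dots,\delta_n$ is associated with the timed word $(a_1,\delta_1)(a_2,\delta_1+\delta_2)\dots(a_n,\delta_1+\dots+\delta_n)$. The language $L(\cdot)\subseteq T\Sigma^+$ is the set of timed words associated with successful runs. A timed one-counter net is a timed one-counter automaton in which no edge uses $empty?$. A timed automaton is the same model without counter (equivalently, all edges use $noop$). **Visibly.** A timed one-counter automaton or net is visibly if $\Sigma$ can be partitioned into pairwise disjoint sets $\Sigma_{\mathsf{int}}\cup\Sigma_{\mathsf{call}}\cup\Sigma_{\mathsf{ret}}$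 such that for every edge $(l,a,\phi,op,\lambda,l')$: $a\in\Sigma_{\mathsf{int}}$ iff $op=noop$; $a\in\Sigma_{\mathsf{call}}$ iff $op=push$; $a\in\Sigma_{\mathsf{ret}}$ iff $op\in\{pop,empty?\}$. **Deterministic.** A timed visibly one-counter net with no clocks is deterministic if for all edges $e=(l,a,\mathtt{true},op',\emptyset,l')$ and $e'=(l,a,\mathtt{true},op'',\emptyset,l'')$ with $e\ne e'$ one has $\{op',op''\}=\{pop,empty?\}$ (since nets have no $empty?$ edges, this means at most one edge per pair $(l,a)$). *)

(* Defs.v *)
From HB Require Import structures.
From mathcomp Require Import classical_sets reals.
From mathcomp Require Import all_boot all_order all_algebra.

Set Implicit Arguments.
Unset Strict Implicit.
Unset Printing Implicit Defensive.

Import Order.TTheory GRing.Theory Num.Theory.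

(** * Partial recursive functions *)

Inductive recfun : nat -> Type :=
| Zero n : recfun n
| Succ : recfun 1
| Proj n : 'I_n -> recfun n
| Comp k n : recfun k -> ('I_k -> recfun n) -> recfun n
| Prec n : recfun n -> recfun n.+2 -> recfun n.+1
| Mu n : recfun n.+1 -> recfun n.

(* [eval f v y]: the partial function denoted by [f] is defined at [v], with
   value [y].  The recursion variable of [Prec] and the search variable of [Mu]
   are the first argument. *)
Fixpoint eval n (f : recfun n) : n.-tuple nat -> nat -> Prop :=
  match f in recfun n return n.-tuple nat -> nat -> Prop with
  | Zero _ => fun _ y => y = 0
  | Succ => fun v y => y = (thead v).+1
  | Proj _ i => fun v y => y = tnth v i
  | Comp k _ f g => fun v y =>
      exists w : k.-tuple nat, (forall i, eval (g i) v (tnth w i)) /\ eval f w y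
  | Prec _ f g => fun v y =>
      exists h : nat -> nat,
        [/\ eval f (behead_tuple v) (h 0),
            forall m, m < thead v ->
              eval g (cons_tuple m (cons_tuple (h m) (behead_tuple v))) (h m.+1)
          & y = h (thead v)]
  | Mu _ f => fun v y =>
      eval f (cons_tuple y v) 0 /\
      (forall m, m < y -> exists z, eval f (cons_tuple m v) z.+1)
  end.

(* A decision problem over [T]: the inputs are the [x] satisfying the promise
   [D], the question is whether [P x] holds.  A decision procedure has to halt
   with the right answer on each input, and is unconstrained elsewhere.  Inputs
   are presented by their code [pickle x]; for the data used below (numbers,
   ordinals, pairs, finite sets and sequences of those) this code is the obvious
   nesting of the bijection [CodeSeq.code : seq nat -> nat]. *)
Definition decidable_problem (T : countType) (D P : T -> Prop) : Prop :=
  exists f : recfun 1, forall x, D x ->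
    exists b : bool, eval f [tuple pickle x] b /\ (b <-> P x).

(** * Timed one-counter automata *)

Inductive cmp := CLt | CLe | CEq | CGe | CGt.

Definition cmp_ord (c : cmp) : 'I_5 :=
  match c with
  | CLt => @Ordinal 5 0 isT
  | CLe => @Ordinal 5 1 isT
  | CEq => @Ordinal 5 2 isT
  | CGe => @Ordinal 5 3 isT
  | CGt => @Ordinal 5 4 isT
  end.

Definition ord_cmp (i : 'I_5) : cmp := nth CGt [:: CLt; CLe; CEq; CGe] i.

Lemma cmp_ordK : cancel cmp_ord ord_cmp.
Proof. by case. Qed.

HB.instance Definition _ := Finite.copy cmp (can_type cmp_ordK).

Inductive counter_op := Push | Pop | Noop | EmptyTest.

Definition op_ord (o : counter_op) : 'I_4 :=
  match o with
  | Push => @Ordinal 4 0 isT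
  | Pop => @Ordinal 4 1 isT
  | Noop => @Ordinal 4 2 isT
  | EmptyTest => @Ordinal 4 3 isT
  end.

Definition ord_op (i : 'I_4) : counter_op := nth EmptyTest [:: Push; Pop; Noop] i.

Lemma op_ordK : cancel op_ord ord_op.
Proof. by case. Qed.

HB.instance Definition _ := Finite.copy counter_op (can_type op_ordK).

(* A conjunction of atomic constraints is the list of its conjuncts, so that
   [::] is the constraint true. *)
Definition constraint (X : finType) : Type := seq (X * cmp * nat).

HB.instance Definition _ (X : finType) := Countable.on (constraint X).

Record edge (Sg L X : finType) := Edge {
  src : L;
  lbl : Sg;
  guard : constraint X;
  cop : counter_op;
  reset : {set X};
  dst : L }.

Section EdgeCountable.
Variables Sg L X : finType.

Definition edge_tuple (e : edge Sg L X) :=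
  (src e, lbl e, guard e, cop e, reset e, dst e).

Definition tuple_edge u : edge Sg L X :=
  let: (l, a, g, o, r, l') := u in Edge l a g o r l'.

Lemma edge_tupleK : cancel edge_tuple tuple_edge.
Proof. by case. Qed.

HB.instance Definition _ := Countable.copy (edge Sg L X) (can_type edge_tupleK).

End EdgeCountable.

(* The list [edges] stands for the finite set of its elements. *)
Record toca (Sg L X : finType) := Toca {
  initial : {set L};
  accepting : {set L};
  edges : seq (edge Sg L X) }.

Section TocaCountable.
Variables Sg L X : finType.

Definition toca_tuple (A : toca Sg L X) := (initial A, accepting A, edges A).

Definition tuple_toca u : toca Sg L X := let: (i, f, E) := u in Toca i f E.

Lemma toca_tupleK : cancel toca_tuple tuple_toca.
Proof. by case. Qed.

HB.instance Definition _ := Countable.copy (toca Sg L X) (can_type toca_tupleK).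

End TocaCountable.

Section Classes.
Variables (Sg L X : finType) (A : toca Sg L X).

Definition one_counter_net : Prop :=
  forall e, e \in edges A -> cop e != EmptyTest.

Definition timed_automaton : Prop :=
  forall e, e \in edges A -> cop e = Noop.

Definition visibly : Prop :=
  exists Sint Scall Sret : {set Sg},
    [/\ Sint :|: Scall :|: Sret = [set: Sg],
        [/\ [disjoint Sint & Scall], [disjoint Sint & Sret]
          & [disjoint Scall & Sret]]
      & forall e, e \in edges A ->
          [/\ lbl e \in Sint <-> cop e = Noop,
              lbl e \in Scall <-> cop e = Push
            & lbl e \in Sret <-> (cop e = Pop \/ cop e = EmptyTest)]].

(* Only meaningful when [X] is empty: then every edge has guard [::] and reset
   set [set0]. *)
Definition deterministic : Prop :=
  forall l a o1 o2 l1 l2,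
    let e1 := Edge l a [::] o1 set0 l1 in
    let e2 := Edge l a [::] o2 set0 l2 in
    e1 \in edges A -> e2 \in edges A -> e1 <> e2 ->
    [set o1; o2] = [set Pop; EmptyTest].

End Classes.

(** * Semantics *)

Local Open Scope ring_scope.
Local Open Scope classical_set_scope.

Section Semantics.
Variable R : realType.

Definition timed_word (Sg : Type) (w : seq (Sg * R)) : Prop :=
  [/\ (0 < size w)%N, all (fun t => 0 <= t) (unzip2 w) & sorted <=%R (unzip2 w)].

Definition cmp_sem (c : cmp) (x y : R) : bool :=
  match c with
  | CLt => x < y
  | CLe => x <= y
  | CEq => x == y
  | CGe => x >= y
  | CGt => x > y
  end.

Definition op_sem (o : counter_op) (m m' : nat) : bool :=
  match o with
  | Push => m' == m.+1
  | Pop => (0 < m)%N && (m' == m.-1)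
  | Noop => m' == m
  | EmptyTest => (m == 0%N) && (m' == 0%N)
  end.

Section Automaton.
Variables (Sg L X : finType).
Implicit Types (A : toca Sg L X) (nu : {ffun X -> R}).

Definition satisfies nu (g : constraint X) : bool :=
  all (fun u => cmp_sem u.1.2 (nu u.1.1) u.2%:R) g.

Definition delay nu (d : R) : {ffun X -> R} := [ffun x => nu x + d].

Definition reset_clocks nu (lam : {set X}) : {ffun X -> R} :=
  [ffun x => if x \in lam then 0 else nu x].

(* Clock values stay nonnegative in every run starting from an initial state,
   as delays are nonnegative. *)
Definition state : Type := (L * {ffun X -> R} * nat)%type.

Definition transition A (s : state) (a : Sg) (d : R) (s' : state) : Prop :=
  let: (l, nu, m) := s in
  let: (l', nu', m') := s' in
  0 <= d /\
  exists e, [/\ e \in edges A, [/\ src e = l, lbl e = a & dst e = l'],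
                satisfies (delay nu d) (guard e),
                nu' = reset_clocks (delay nu d) (reset e)
              & op_sem (cop e) m m'].

(* [run A s r s']: a run from [s] to [s'] whose successive letters and delays
   are given by [r]. *)
Fixpoint run A (s : state) (r : seq (Sg * R)) (s' : state) : Prop :=
  if r is (a, d) :: r' then
    exists2 s1, transition A s a d s1 & run A s1 r' s'
  else s = s'.

Definition initial_state A (s : state) : Prop :=
  exists2 l, l \in initial A & s = (l, [ffun=> 0], 0%N).

Definition successful A (s : state) (r : seq (Sg * R)) (s' : state) : Prop :=
  [/\ initial_state A s, run A s r s' & s'.1.1 \in accepting A].

(* [scanl +%R 0] turns delays into absolute times. *)
Definition associated_word (r : seq (Sg * R)) : seq (Sg * R) :=
  zip (unzip1 r) (scanl +%R 0 (unzip2 r)).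

(* The conjunct [timed_word w] only discards the empty run. *)
Definition language A : set (seq (Sg * R)) :=
  [set w | timed_word w /\
     exists s r s', successful A s r s' /\ w = associated_word r].

End Automaton.
End Semantics.

Arguments language R {Sg L X} A.

(** * Instances of the inclusion problem *)

(* Finite alphabets, sets of locations and sets of clocks are taken, up to
   renaming, to be of the form [{0, ..., n-1}]. *)
Record automaton (k : nat) := Automaton {
  nloc : nat;
  nclk : nat;
  aut :> toca 'I_k 'I_nloc 'I_nclk }.

Section AutomatonCountable.
Variable k : nat.

Definition automaton_tag (A : automaton k) :
    {n : nat & {c : nat & toca 'I_k 'I_n 'I_c}} :=
  existT _ (nloc A) (existT _ (nclk A) (aut A)).

Definition tag_automaton (u : {n : nat & {c : nat & toca 'I_k 'I_n 'I_c}}) :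
    automaton k :=
  let: existT n (existT c A) := u in @Automaton k n c A.

Lemma automaton_tagK : cancel automaton_tag tag_automaton.
Proof. by case. Qed.

HB.instance Definition _ :=
  Countable.copy (automaton k) (can_type automaton_tagK).

End AutomatonCountable.

Record inclusion_instance := InclusionInstance {
  alphabet_size : nat;
  left_aut : automaton alphabet_size;
  right_aut : automaton alphabet_size }.

Definition instance_tag (I : inclusion_instance) :
    {k : nat & (automaton k * automaton k)%type} :=
  existT _ (alphabet_size I) (left_aut I, right_aut I).

Definition tag_instance (u : {k : nat & (automaton k * automaton k)%type}) :
    inclusion_instance :=
  let: existT k (A, B) := u in @InclusionInstance k A B.

Lemma instance_tagK : cancel instance_tag tag_instance.
Proof. by case. Qed.

HB.instance Definition _ :=
  Countable.copy inclusion_instance (can_type instance_tagK).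

(* Main.v *)
Require Import Defs.
From mathcomp Require Import all_boot all_order all_algebra zify ring lra.
From mathcomp Require Import classical_sets boolp reals.

(** The decision procedure, a recursive function, is turned against itself.  A
    counter program [p] with increments, blocking decrements and blocking zero
    tests is run by a net reading the letters [inc j], [dec j], [tst j], whose
    counter holds the sum of all registers.  The values of the registers are
    kept in the timing: each [inc j] creates a symbol, which has to reappear
    exactly one time unit later, as [cpy j], or as [dec j] when it disappears.  A
    one-clock automaton can guess a symbol that is not renewed, or a test [tst j]
    passed while a symbol of [j] is alive; it cannot see spurious events [cpy j]
    and [dec j].  But those make the number of live symbols exceed the counter
    for good, and at the end all live symbols have to be consumed by [dec j],
    that is, by pops.  So the inclusion fails iff [p] halts.

    For the diagonal, [p] applies the decision procedure to the code of the
    instance determined by its input (a, b), and halts iff the answer is yes.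
    That instance consists of a net whose edges are a loader, which stores a and b
    in the registers, followed by the list with code a, and of the timed
    automaton with code b; the map from (a, b) to its code is recursive.  Choosing
    a and b as the codes of the control graph of [p] and of the automaton that
    goes with [p] gives the contradiction. *)

Set Implicit Arguments.
Unset Strict Implicit.
Unset Printing Implicit Defensive.

Import Order.TTheory GRing.Theory Num.Theory.

(** * Computable functions *)

(** Only the values on lists of length [n] matter; lists spare the dependent types of tuples when
    arguments are rearranged. *)
Definition computable n (h : seq nat -> nat) : Prop :=
  exists e : recfun n, forall v : n.-tuple nat, eval e v (h v).

Lemma eq_computable n h h' :
  (forall s, size s = n -> h s = h' s) -> computable n h -> computable n h'.
Proof. by move=> hh' [e eP]; exists e => v; rewrite -hh' ?size_tuple. Qed.

Lemma computable_proj n i : i < n -> computable n (fun s => nth 0 s i).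
Proof. by move=> lt_in; exists (Proj (Ordinal lt_in)) => v /=; rewrite (tnth_nth 0). Qed.

Lemma computable_comp k n h (g : nat -> seq nat -> nat) :
  computable k h -> (forall i, i < k -> computable n (g i)) ->
  computable n (fun s => h (mkseq (g^~ s) k)).
Proof.
move=> [e eP] gP.
have /fin_all_exists[e' e'P] (i : 'I_k) :
    exists e', forall v : n.-tuple nat, eval e' v (g i v) by exact: gP.
exists (Comp e e') => v /=.
have sz : size (mkseq (g^~ v) k) == k by rewrite size_mkseq.
exists (Tuple sz); split=> [i|]; last exact: eP.
by rewrite (tnth_nth 0) /= nth_mkseq.
Qed.

Lemma computable_succ n h : computable n h -> computable n (fun s => (h s).+1).
Proof.
have succP : computable 1 (fun s => (head 0 s).+1).
  by exists Succ => -[[|a []] //= sz]; rewrite theadE.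
by move=> hP; apply: (computable_comp (g := fun=> h) succP).
Qed.

Lemma computable_const n c : computable n (fun=> c).
Proof. by elim: c => [|c /computable_succ //]; exists (@Zero n). Qed.

Lemma computable_prec n b st : computable n b -> computable n.+2 st ->
  computable n.+1 (fun s =>
    iteri (head 0 s) (fun m acc => st [:: m, acc & behead s]) (b (behead s))).
Proof.
move=> [e eP] [e' e'P]; exists (Prec e e') => v /=.
exists (fun m => iteri m (fun m acc => st [:: m, acc & behead v]) (b (behead v))).
split=> [||]; first exact: eP.
  by move=> m _; apply: e'P.
by case/tupleP: v => a v; rewrite theadE.
Qed.

(** Obtained from [computable_prec] at the arguments [c s :: s], so that bound, start and step may
    all read the whole of [s]. *)
Lemma computable_iteri n c b st :
  computable n c -> computable n b -> computable n.+2 st ->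
  computable n (fun s => iteri (c s) (fun m acc => st [:: m, acc & s]) (b s)).
Proof.
move=> cP bP stP.
have := computable_comp (g := fun i s => if i is j.+1 then nth 0 s j else c s)
  (computable_prec bP stP).
move=> /(_ n) prP; apply: (eq_computable _ (prP _)) => [s szs|[|i] lt_in //].
  have -> : mkseq (fun i => if i is j.+1 then nth 0 s j else c s) n.+1 = c s :: s.
    by rewrite /mkseq /= (iotaDl 1 0) -map_comp -szs (eq_map (g := nth 0 s)) //
               map_nth_iota0 ?take_size.
  by [].
exact: computable_proj.
Qed.

Lemma computable_shift2 n h :
  computable n h -> computable n.+2 (fun s => h (behead (behead s))).
Proof.
move=> hP; have := computable_comp (g := fun i s => nth 0 s i.+2) hP.
move=> /(_ n.+2) h2P; apply: (eq_computable _ (h2P _)) => [[|a [|b s]] // [szs]|].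
  by congr h; rewrite -[RHS](mkseq_nth 0) szs.
by move=> i lt_in; apply: computable_proj.
Qed.

Lemma computable_add n f g :
  computable n f -> computable n g -> computable n (fun s => f s + g s).
Proof.
move=> fP gP; apply: eq_computable (computable_iteri (st := fun s => (nth 0 s 1).+1) gP fP _).
  by move=> s _; elim: (g s) => [|k IHk] //=; rewrite ?addn0 // IHk addnS.
exact: computable_succ (computable_proj _).
Qed.

Lemma computable_mul n f g :
  computable n f -> computable n g -> computable n (fun s => f s * g s).
Proof.
move=> fP gP; apply: eq_computable (computable_iteri
  (st := fun s => nth 0 s 1 + f (behead (behead s))) gP (computable_const n 0) _).
  by move=> s _; elim: (g s) => [|k IHk] //=; rewrite ?muln0 // IHk mulnS addnC.
by apply: computable_add; [exact: computable_proj | exact: computable_shift2].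
Qed.

Lemma computable_exp2 n f : computable n f -> computable n (fun s => 2 ^ f s).
Proof.
move=> fP; apply: eq_computable (computable_iteri
  (st := fun s => 2 * nth 0 s 1) fP (computable_const n 1) _).
  by move=> s _; elim: (f s) => [|k IHk] //=; rewrite IHk expnS.
by apply: computable_mul; [exact: computable_const | exact: computable_proj].
Qed.

Lemma computable_pred n f : computable n f -> computable n (fun s => (f s).-1).
Proof.
move=> fP; apply: eq_computable (computable_iteri
  (st := fun s => nth 0 s 0) fP (computable_const n 0) _).
  by move=> s _; case: (f s).
exact: computable_proj.
Qed.

Lemma computable_sub n f g :
  computable n f -> computable n g -> computable n (fun s => f s - g s).
Proof.
move=> fP gP; apply: eq_computable (computable_iteri
  (st := fun s => (nth 0 s 1).-1) gP fP _).
  by move=> s _; elim: (g s) => [|k IHk] //=; rewrite ?subn0 // IHk subnS.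
exact: computable_pred (computable_proj _).
Qed.

Lemma computable_eq n f g :
  computable n f -> computable n g -> computable n (fun s => f s == g s).
Proof.
(* Subtraction is truncated, so the sum of both differences vanishes exactly at equality. *)
move=> fP gP; apply: (eq_computable (h := fun s => 1 - ((f s - g s) + (g s - f s)))).
  by move=> s _; case: eqP => /=; lia.
by apply: computable_sub; [exact: computable_const |
  apply: computable_add; apply: computable_sub].
Qed.

(** One step of [CodeSeq.code]: it prefixes an entry to a list known by its code, without decoding
    that list. *)
Definition code_cons a s := 2 ^ a * s.*2.+1.

Lemma computable_code_cons n f g :
  computable n f -> computable n g -> computable n (fun s => code_cons (f s) (g s)).
Proof.
move=> fP gP; apply: (eq_computable (h := fun s => 2 ^ f s * (g s + g s).+1)).
  by move=> s _; rewrite /code_cons addnn.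
by apply: computable_mul; [exact: computable_exp2 |
  exact/computable_succ/computable_add].
Qed.

Lemma code_cat s t : CodeSeq.code (s ++ t) = foldr code_cons (CodeSeq.code t) s.
Proof. by rewrite /CodeSeq.code foldr_cat. Qed.

(** Puts a list whose length and entries depend on the arguments in front of a list given by its
    code. The last entry is added first, so round [m] adds the entry of index [c s - m.+1]. *)
Lemma computable_code_mkseq n c t h :
  computable n c -> computable n t ->
  computable n.+2 (fun s => h (head 0 s) (behead (behead s))) ->
  computable n (fun s => foldr code_cons (t s) (mkseq (h^~ s) (c s))).
Proof.
move=> cP tP hP; apply: eq_computable (computable_iteri
  (st := fun s => code_cons (h (c (behead (behead s)) - (head 0 s).+1)
                               (behead (behead s))) (nth 0 s 1))
   cP tP _) => [s _|].
  have E k : k <= c s -> iteri k (fun m acc => code_cons (h (c s - m.+1) s) acc) (t s)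
      = foldr code_cons (t s) [seq h i s | i <- iota (c s - k) k].
    elim: k => [|k IHk] // lt_kc; rewrite iteriS IHk 1?ltnW //=.
    by rewrite -subSn // subSS.
  by rewrite /= E // subnn.
apply: computable_code_cons; last exact: computable_proj.
apply: (eq_computable (h := fun s => (fun u => h (head 0 u) (behead (behead u)))
  (mkseq (fun i => if i is 0 then c (behead (behead s)) - (head 0 s).+1 else nth 0 s i) n.+2))).
  case=> [|a [|b s]] // [szs] /=; congr h; rewrite /mkseq /= (iotaDl 2 0) -map_comp.
  by rewrite -[RHS](mkseq_nth 0) szs.
apply: (computable_comp (g := fun i s => if i is 0 then _ else nth 0 s i) hP) => -[_|i lt_in];
  last exact: computable_proj.
apply: computable_sub; first exact: computable_shift2.
apply/computable_succ/(eq_computable (h := nth 0 ^~ 0)) => [s _|].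
  exact: nth0.
exact: computable_proj.
Qed.

(** * Counter programs *)

(* The letters of register [j] are [4 * j], ..., [4 * j + 3]. *)
Definition reg (a : nat) := a %/ 4.
Definition kind (a : nat) := a %% 4.
Definition cpy j := 4 * j.
Definition inc j := (4 * j).+1.
Definition dec j := (4 * j).+2.
Definition tst j := (4 * j).+3.

Lemma regK j : (reg (cpy j) = j) * (reg (inc j) = j) * (reg (dec j) = j) * (reg (tst j) = j).
Proof. by rewrite /reg /cpy /inc /dec /tst; do !split; lia. Qed.

Lemma kindK j : (kind (cpy j) = 0) * (kind (inc j) = 1) * (kind (dec j) = 2) * (kind (tst j) = 3).
Proof. by rewrite /kind /cpy /inc /dec /tst; do !split; lia. Qed.

Lemma letterP a : [\/ a = cpy (reg a), a = inc (reg a), a = dec (reg a) | a = tst (reg a)].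
Proof.
rewrite /cpy /inc /dec /tst /reg; have := ltn_pmod a (isT : 0 < 4).
case E: (a %% 4) => [|[|[|[|?]]]] // _; [constructor 1|constructor 2|constructor 3|constructor 4]; lia.
Qed.

Definition cfg : Type := (nat * (nat -> nat))%type.
Definition upd (v : nat -> nat) j x : nat -> nat := fun i => if i == j then x else v i.

Section Machine.
Variable E : seq (nat * nat * nat).

(** Letters [cpy j] make no step: renewing a symbol leaves the registers as they are. *)
Inductive step : cfg -> cfg -> Prop :=
| StepInc l j l' v : (l, inc j, l') \in E -> step (l, v) (l', upd v j (v j).+1)
| StepDec l j l' v : (l, dec j, l') \in E -> 0 < v j ->
    step (l, v) (l', upd v j (v j).-1)
| StepTst l j l' v : (l, tst j, l') \in E -> v j = 0 -> step (l, v) (l', v).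

(** Necessary conditions for a step, by which a configuration is later seen to be stuck. *)
Lemma step_edge l v c : step (l, v) c -> exists x l',
  [/\ (l, x, l') \in E, 0 < kind x & forall j, x = dec j -> 0 < v j].
Proof.
move=> S; inversion S as [? j l' ? eE|? j l' ? eE v_gt0|? j l' ? eE]; subst;
  eexists; eexists; (split; first exact: eE); rewrite ?kindK // => i.
- by move/(congr1 kind); rewrite !kindK.
- by move/(congr1 reg); rewrite !regK => <-.
by move/(congr1 kind); rewrite !kindK.
Qed.

Inductive reach : cfg -> cfg -> Prop :=
| ReachRefl c : reach c c
| ReachStep c1 c2 c3 : step c1 c2 -> reach c2 c3 -> reach c1 c3.

Lemma step_reach c1 c2 : step c1 c2 -> reach c1 c2.
Proof. by move=> c12; apply: ReachStep c12 (ReachRefl _). Qed.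

Lemma reach_trans c1 c2 c3 : reach c1 c2 -> reach c2 c3 -> reach c1 c3.
Proof. by elim=> [//|c c' c'' cc' _ IH /IH]; apply: ReachStep. Qed.

End Machine.

Lemma sub_reach E E' c c' : {subset E <= E'} -> reach E c c' -> reach E' c c'.
Proof.
move=> sEE'; elim=> {c c'} [c|c1 c2 c3 c12 _]; first exact: ReachRefl.
apply: ReachStep; case: c12 => l j l' v /sEE' lE'; first exact: StepInc.
  exact: StepDec.
by move=> vj0; apply: StepTst lE' vj0.
Qed.

(** * Structured programs and their control graphs *)

(* [Loop r p]: while [r] is nonzero, decrement it and do [p]. *)
Inductive prog := Inc of nat | Dec of nat | Seq of prog & prog | Loop of nat & prog.

Fixpoint fresh p :=
  match p with
  | Inc _ | Dec _ => 0
  | Seq p q => (fresh p + fresh q).+2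
  | Loop _ p => (fresh p).+2
  end.

(* Control graph of [p] from [s] to [t], whose inner nodes are [n], [n + 2],
   ..., [n + fresh p - 2]; the nodes of the other parity are left to the loader
   of the input. *)
Fixpoint graph p s t n : seq (nat * nat * nat) :=
  match p with
  | Inc j => [:: (s, inc j, t)]
  | Dec j => [:: (s, dec j, t)]
  | Seq p q => graph p s n n.+2 ++ graph q n t (n.+2 + fresh p)
  | Loop r p => [:: (s, tst r, t), (s, dec r, n) & graph p n s n.+2]
  end.

(** Possibility only; uniqueness of the run comes from the determinism of the graph. Quantifying
    over [s], [t] and [n] lets programs be composed. *)
Definition runs p v v' := forall s t n, reach (graph p s t n) (s, v) (t, v').

Lemma runs_inc j v : runs (Inc j) v (upd v j (v j).+1).
Proof. by move=> s t n; apply/step_reach/StepInc; rewrite inE. Qed.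

Lemma runs_dec j v : 0 < v j -> runs (Dec j) v (upd v j (v j).-1).
Proof. by move=> v_gt0 s t n; apply/step_reach/StepDec; rewrite // inE. Qed.

Lemma runs_seq p q v v1 v2 : runs p v v1 -> runs q v1 v2 -> runs (Seq p q) v v2.
Proof.
move=> pP qP s t n; apply: (reach_trans (c2 := (n, v1))).
  by apply: sub_reach (pP s n n.+2) => e; rewrite mem_cat => ->.
by apply: sub_reach (qP n t (n.+2 + fresh p)) => e; rewrite mem_cat => ->; rewrite orbT.
Qed.

Lemma runs_loop0 r p v : v r = 0 -> runs (Loop r p) v v.
Proof. by move=> vr0 s t n; apply/step_reach/(StepTst _ vr0); rewrite inE eqxx. Qed.

Lemma runs_loopS r p v v1 v2 : 0 < v r -> runs p (upd v r (v r).-1) v1 ->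
  runs (Loop r p) v1 v2 -> runs (Loop r p) v v2.
Proof.
move=> vr_gt0 pP lP s t n; apply: reach_trans (lP s t n).
apply: ReachStep (StepDec (j := r) (l' := n) _ vr_gt0) _.
  by rewrite !inE eqxx orbT.
by apply: sub_reach (pP n s n.+2) => e; rewrite !inE => ->; rewrite !orbT.
Qed.

Lemma runs_eq p v v1 v2 : runs p v v1 -> v1 =1 v2 -> runs p v v2.
Proof. by move=> pP /funext <-. Qed.

Ltac upd_tac := rewrite /upd /=; repeat (case: eqP => //= ?); try lia; subst; try lia.

(** Here [st m] is the intended content of the registers after [m] rounds; the body starts with [r]
    already decremented to [n - m.+1]. *)
Lemma runs_loop_iter r p n st : (forall m, m <= n -> st m r = n - m) ->
  (forall m, m < n -> runs p (upd (st m) r (n - m.+1)) (st m.+1)) ->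
  runs (Loop r p) (st 0) (st n).
Proof.
move=> rP pP.
suff E k : k <= n -> runs (Loop r p) (st (n - k)) (st n) by rewrite -(subnn n); apply: E.
elim: k => [_|k IHk lt_kn]; first by rewrite subn0; apply: runs_loop0; rewrite rP ?subnn.
have E1 : n - k = (n - k.+1).+1 by lia.
apply: runs_loopS (IHk (ltnW lt_kn)); first by rewrite rP ?leq_subr; lia.
rewrite E1; have := pP (n - k.+1); rewrite rP ?leq_subr //.
by have -> : (n - (n - k.+1)).-1 = n - (n - k.+1).+1 by [lia]; apply; lia.
Qed.

(** There is no empty program; an increment taken back at once does nothing. *)
Definition Skip := Seq (Inc 0) (Dec 0).

Lemma runs_skip v : runs Skip v v.
Proof.
apply: runs_seq (runs_inc _ _) _; apply: runs_eq (runs_dec _) _; first by upd_tac.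
by move=> i; upd_tac.
Qed.

Definition Clear r := Loop r Skip.

Lemma runs_clear r v : runs (Clear r) v (upd v r 0).
Proof.
have := runs_loop_iter (r := r) (p := Skip) (n := v r) (st := fun m => upd v r (v r - m)).
rewrite subnn => lP; have -> : v = upd v r (v r - 0) by apply/funext=> i; upd_tac.
have -> : upd (upd v r (v r - 0)) r 0 = upd v r 0 by apply/funext=> i; upd_tac.
apply: lP => [m|m lt_m]; first by upd_tac.
apply: runs_eq (runs_skip _) _ => i; upd_tac.
Qed.

Definition Move s d := Loop s (Inc d).

Lemma runs_move s d v : s <> d ->
  runs (Move s d) v (upd (upd v d (v d + v s)) s 0).
Proof.
move=> neq_sd; have := runs_loop_iter (r := s) (p := Inc d) (n := v s)
  (st := fun m => upd (upd v d (v d + m)) s (v s - m)).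
rewrite subnn => lP; have E : v = upd (upd v d (v d + 0)) s (v s - 0).
  by apply/funext=> i; upd_tac.
rewrite {1}E; apply: lP => [m|m lt_m]; first by upd_tac.
apply: runs_eq (runs_inc _ _) _ => i; upd_tac.
Qed.

(** Reading [s] empties it, so its value goes to both [d] and [t], and [t] gives it back. *)
Definition Copy s d t := Seq (Loop s (Seq (Inc d) (Inc t))) (Move t s).

Lemma runs_copy s d t v : s <> d -> s <> t -> d <> t -> v t = 0 ->
  runs (Copy s d t) v (upd v d (v d + v s)).
Proof.
move=> sd st dt vt0.
have lP := runs_loop_iter (r := s) (p := Seq (Inc d) (Inc t)) (n := v s)
  (st := fun m => upd (upd (upd v d (v d + m)) t m) s (v s - m)).
apply: (runs_seq (v1 := upd (upd (upd v d (v d + v s)) t (v s)) s 0)).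
  rewrite subnn in lP; have E : v = upd (upd (upd v d (v d + 0)) t 0) s (v s - 0).
    by apply/funext=> i; upd_tac.
  rewrite {1}E; apply: lP => [m|m lt_m]; first by upd_tac.
  apply: runs_seq (runs_inc _ _) _; apply: runs_eq (runs_inc _ _) _ => i; upd_tac.
apply: runs_eq (runs_move _ _) _ => [|i]; first by move/esym.
upd_tac.
Qed.

Lemma runs_foldr T (F : T -> prog) x0 (s : seq T) (st : nat -> nat -> nat) :
  (forall m, m < size s -> runs (F (nth x0 s m)) (st m) (st m.+1)) ->
  runs (foldr (fun i p => Seq (F i) p) Skip s) (st 0) (st (size s)).
Proof.
elim: s st => [|x s IHs] st sP /=; first exact: runs_skip.
by apply: runs_seq (sP 0 isT) (IHs (st \o succn) _) => m lt_m; apply: (sP m.+1).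
Qed.

(** * Compilation of recursive functions *)

Definition scons T (x : T) (f : nat -> T) i := if i is i'.+1 then f i' else x.

(* The arguments of [f] are in the registers [args 0], [args 1], ...; those from
   [base] on are scratch registers, equal to 0 before and after. *)
Fixpoint compile n (f : recfun n) (args : nat -> nat) (out base : nat) : prog :=
  match f with
  | Zero _ => Skip
  | Succ => Seq (Copy (args 0) out base) (Inc out)
  | Proj _ i => Copy (args i) out base
  | Comp k _ f g =>
      Seq (foldr (fun i p => Seq (compile (g i) args (base + i) (base + k)) p)
             Skip (enum 'I_k))
     (Seq (compile f (addn base) out (base + k))
          (foldr (fun i p => Seq (Clear (base + i)) p) Skip (iota 0 k)))
  | Prec _ f g =>
      let rest i := args i.+1 in
      Seq (Copy (args 0) base.+2 base.+3)
     (Seq (compile f rest base.+1 base.+4)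
     (Seq (Loop base.+2
       (Seq (compile g (scons base (scons base.+1 rest)) base.+3 base.+4)
       (Seq (Clear base.+1)
       (Seq (Move base.+3 base.+1)
            (Inc base)))))
     (Seq (Move base.+1 out)
          (Clear base))))
  | Mu _ f =>
      let args' := scons base args in
      Seq (compile f args' base.+1 base.+2)
     (Seq (Loop base.+1
       (Seq (Clear base.+1)
       (Seq (Inc base)
            (compile f args' base.+1 base.+2))))
          (Move base out))
  end.

(** Induction on [f]. A subprogram is called with a [base] above all registers in use, so its
    scratch registers are zero and its arguments safe; leaving the scratch registers at zero allows
    the next call. *)
Lemma runs_compile n (f : recfun n) args out base v (x : n.-tuple nat) y :
  eval f x y -> (forall i, i < n -> v (args i) = nth 0 x i) ->
  (forall i, i < n -> args i < base /\ args i <> out) -> out < base ->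
  v out = 0 -> (forall r, base <= r -> v r = 0) ->
  runs (compile f args out base) v (upd v out y).
Proof.
elim: f args out base v x y => {n}
  [n|/=|n i|k n f IHf g IHg|n f IHf g IHg|n f IHf] args out base v x y /=.
- by move=> -> _ _ _ v0 _; apply: runs_eq (runs_skip _) _ => i; upd_tac.
- move=> -> vx lt_args lt_out v0 vb; have [lt0 neq0] := lt_args 0 isT.
  apply: runs_seq (runs_copy _ _ _ _) _ => //; try lia; first exact: vb.
  apply: runs_eq (runs_inc _ _) _ => i; have := vx 0 isT.
  by case/tupleP: x {vx} => a x /=; rewrite theadE; upd_tac.
- move=> -> vx lt_args lt_out v0 vb; have [lt0 neq0] := lt_args i (ltn_ord i).
  apply: runs_eq (runs_copy _ _ _ _) _ => //; try lia; first exact: vb.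
  by move=> r; rewrite (tnth_nth 0) v0 vx.
- case=> w [wP yP] vx lt_args lt_out v0 vb.
  (* After [m] calls the first [m] components of [w] lie in the registers from [base] on. *)
  pose st m r := if base <= r < base + m then nth 0 w (r - base) else v r.
  have st0 : v = st 0 by apply/funext=> r; rewrite /st; case: ifP => //; lia.
  apply: (runs_seq (v1 := st k)).
    rewrite {1}st0; have -> : st k = st (size (enum 'I_k)) by rewrite size_enum_ord.
    (* [nth] on [enum 'I_k] needs a default element, hence the separate case [k = 0]. *)
    case: k f g IHf IHg w wP yP @st st0 => [|k] f g IHf IHg w wP yP st st0.
      rewrite (_ : enum 'I_0 = [::]) /=; first exact: runs_skip.
      by apply: size0nil; rewrite size_enum_ord.
    apply: (runs_foldr (x0 := ord0)) => m; rewrite size_enum_ord => lt_m.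
    set i := nth _ _ _; have Ei : i = m :> nat by rewrite nth_enum_ord.
    apply: (runs_eq (v1 := upd (st m) (base + i) (nth 0 w i))).
    apply: (IHg i args (base + i) (base + k.+1) (st m) x).
    + by rewrite -tnth_nth.
    + by move=> j /[dup] /vx vj /lt_args[lt_j _]; rewrite /st ifF //; lia.
    + by move=> j /lt_args[lt_j _]; lia.
    + lia.
    + by rewrite /st ifF ?vb //; lia.
    + by move=> r le_r; rewrite /st ifF ?vb //; lia.
    move=> r; rewrite /st /upd; case: eqP => [->|].
      by rewrite ifT ?addKn //; lia.
    by case: ifP => ? ?; case: ifP => //; lia.
  apply: (runs_seq (v1 := upd (st k) out y)).
    apply: (IHf _ _ _ _ w y) => //.
    + by move=> i lt_i; rewrite /st ifT ?addKn //; lia.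
    + lia.
    + lia.
    + by rewrite /st ifF //; lia.
    by move=> r le_r; rewrite /st ifF ?vb //; lia.
  (* The intermediate results are cleared from [base] upwards, once [out] has received [y]. *)
  pose st' m r := if base + m <= r < base + k then nth 0 w (r - base) else upd v out y r.
  have -> : upd (st k) out y = st' 0.
    apply/funext=> r; rewrite /st' /st /upd addn0; case: eqP => // ->.
    by rewrite ifF //; lia.
  have -> : upd v out y = st' (size (iota 0 k)).
    by apply/funext=> r; rewrite /st' size_iota; case: ifP => //; lia.
  apply: (runs_foldr (x0 := 0)) => m; rewrite size_iota => lt_m.
  rewrite nth_iota //; apply: runs_eq (runs_clear _ _) _ => r.
  rewrite /st' /upd; case: eqP => [->|?].
    by rewrite ifF; [case: eqP => [|_]; [lia|rewrite vb //; lia] | lia].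
  by have -> : (base + m <= r < base + k) = (base + m.+1 <= r < base + k) by lia.
- case=> h [h0 hS ->] vx lt_args lt_out v0 vb.
  have [lt0 neq0] := lt_args 0 isT; set n0 := thead x.
  have v_n0 : v (args 0) = n0 by rewrite vx // /n0 /thead (tnth_nth 0).
  (* Invariant of the loop: [base] counts the rounds, [base.+1] holds the current value, [base.+2]
     the number of rounds left. *)
  pose st m r := if r == base then m else if r == base.+1 then h m
                 else if r == base.+2 then n0 - m else v r.
  have st_lo m r : r < base -> st m r = v r by move=> ?; rewrite /st !ifF //; lia.
  have st_hi m r : base.+2 < r -> st m r = v r by move=> ?; rewrite /st !ifF //; lia.
  have st_0 m : st m base = m by rewrite /st eqxx.
  have st_1 m : st m base.+1 = h m by rewrite /st ifF ?eqxx //; lia.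
  have st_2 m : st m base.+2 = n0 - m.
    by rewrite /st ifF; [rewrite ifF ?eqxx //; lia | lia].
  have rest_x i : i < n -> v (args i.+1) = nth 0 (behead x) i.
    by move=> lt_i; rewrite nth_behead vx.
  apply: runs_seq (runs_copy _ _ _ _) _; [lia|lia|lia|by apply: vb; lia|].
  apply: (runs_seq (v1 := st 0)).
    apply: runs_eq (IHf _ _ _ _ (behead_tuple x) (h 0) _ _ _ _ _ _) _ => //.
    + by move=> i lt_i; rewrite -rest_x //; have [] := lt_args i.+1 lt_i; upd_tac.
    + by move=> i lt_i; have [] := lt_args i.+1 lt_i; lia.
    + lia.
    + by upd_tac; apply: vb; lia.
    + by move=> r le_r; upd_tac; apply: vb; lia.
    move=> r; rewrite /upd /st (vb base.+2) ?add0n ?v_n0 ?subn0; last by lia.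
    by have := vb base (leqnn _); do 4?case: eqP => //; move=> *; subst; lia.
  apply: (runs_seq (v1 := st n0)).
    apply: runs_loop_iter => [m le_m|m lt_m]; first exact: st_2.
    have stE r : upd (st m) base.+2 (n0 - m.+1) r = if r == base.+2 then n0 - m.+1 else st m r by [].
    apply: runs_seq (IHg _ _ _ _ (cons_tuple m (cons_tuple (h m) (behead_tuple x))) (h m.+1) _ _ _ _ _ _) _.
    + exact: hS.
    + case=> [|[|i]] lt_i /=; rewrite stE /=.
      * by rewrite ifF ?st_0 //; lia.
      * by rewrite ifF ?st_1 //; lia.
      have [lt_ai _] := lt_args i.+1 lt_i.
      by rewrite ifF ?st_lo ?rest_x //; lia.
    + by case=> [|[|i]] lt_i /=; try lia; have [] := lt_args i.+1 lt_i; lia.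
    + lia.
    + by rewrite stE ifF ?st_hi ?vb //; lia.
    + by move=> r le_r; rewrite stE ifF ?st_hi ?vb //; lia.
    apply: runs_seq (runs_clear _ _) _.
    apply: runs_seq (runs_move _ _) _; first by lia.
    apply: runs_eq (runs_inc _ _) _ => r.
    rewrite /upd /st; have := vb base.+3 (leqW (leqW (leqW (leqnn _)))).
    by move=> vb3; upd_tac.
  apply: runs_seq (runs_move _ _) _; first by lia.
  apply: runs_eq (runs_clear _ _) _ => r.
  rewrite /upd /st; have := vb base (leqnn _); have := vb base.+1 (leqW (leqnn _)).
  have := vb base.+2 (leqW (leqW (leqnn _))).
  by upd_tac.
case=> y0 yP vx lt_args lt_out v0 vb.
(* The values of [f] at the arguments up to [y]; beyond [y], where [f] may be undefined, [z] is
   arbitrary. *)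
have /choice[z zP] m : exists z, m <= y -> eval f (cons_tuple m x) z /\ (m < y -> 0 < z) /\ (m = y -> z = 0).
  have [lt_my|le_ym] := ltnP m y.
    by have [z zP] := yP m lt_my; exists z.+1; split=> //; split=> //; lia.
  by exists 0 => le_my; have -> : m = y by [lia]; split=> //; split=> //; lia.
pose st m r := if r == base then m else if r == base.+1 then z m else v r.
have st_lo m r : r < base -> st m r = v r by move=> ?; rewrite /st !ifF //; lia.
have st_hi m r : base.+1 < r -> st m r = v r by move=> ?; rewrite /st !ifF //; lia.
have IHf' m u : m <= y -> u =1 (fun r => if r == base then m else v r) ->
    runs (compile f (scons base args) base.+1 base.+2) u (st m).
  move=> le_my uE; have [ezm _] := zP m le_my.
  apply: runs_eq (IHf _ _ _ _ (cons_tuple m x) (z m) ezm _ _ _ _ _) _ => /=.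
  + case=> [|i] lt_i /=; rewrite uE ?eqxx //.
    by have [? _] := lt_args i lt_i; rewrite ifF ?vx //; lia.
  + by case=> [|i] lt_i /=; [lia|have [] := lt_args i lt_i; lia].
  + lia.
  + by rewrite uE ifF ?vb //; lia.
  + by move=> r le_r; rewrite uE ifF ?vb //; lia.
  move=> r; rewrite /upd /st; case: eqP => [->|_]; last by rewrite uE.
  by rewrite ifF //; lia.
apply: runs_seq (IHf' 0 _ _ _) _ => // [r|].
  by case: eqP => // ->; rewrite vb.
apply: (runs_seq (v1 := st y)).
  (* [runs_loop_iter] does not apply, as the tested register receives a new value of [f] in each
     round; the induction is on the number of rounds left. *)
  suff E k : k <= y -> runs (Loop base.+1 (Seq (Clear base.+1) (Seq (Inc base)
      (compile f (scons base args) base.+1 base.+2)))) (st (y - k)) (st y).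
    by rewrite -(subnn y); apply: E.
  elim: k => [_|k IHk lt_ky].
    rewrite subn0; apply: runs_loop0; rewrite /st ifF ?eqxx; last by lia.
    by have [_ [_ ->]] := zP y (leqnn y).
  have E1 : (y - k.+1).+1 = y - k by lia.
  apply: runs_loopS (IHk (ltnW lt_ky)).
    rewrite /st ifF ?eqxx; last by lia.
    by have [|_ [-> //]] := zP (y - k.+1) _; lia.
  apply: runs_seq (runs_clear _ _) _.
  apply: runs_seq (runs_inc _ _) _.
  apply: IHf' => [|r]; first by lia.
  by rewrite /st; have := vb base.+1 (leqW (leqnn _)); upd_tac.
apply: runs_eq (runs_move _ _) _; first by lia.
by move=> r; have [_ [_ zy]] := zP y (leqnn y); rewrite /st;
  have := vb base (leqnn _); have := vb base.+1 (leqW (leqnn _)); rewrite zy //; upd_tac.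
Qed.

(** * Shape and determinism of control graphs *)

Fixpoint regs p :=
  match p with
  | Inc j | Dec j => j.+1
  | Seq p q => maxn (regs p) (regs q)
  | Loop r p => maxn r.+1 (regs p)
  end.

Lemma graph_letter p s t n l a l' : (l, a, l') \in graph p s t n ->
  reg a < regs p /\ 0 < kind a.
Proof.
elim: p s t n => [j|j|p IHp q IHq|r p IHp] s t n /=.
- by rewrite inE => /eqP[_ -> _]; rewrite regK kindK.
- by rewrite inE => /eqP[_ -> _]; rewrite regK kindK.
- by rewrite mem_cat => /orP[/IHp|/IHq] [lt_a ka]; rewrite leq_max lt_a ?orbT.
rewrite !inE => /or3P[/eqP[_ -> _]|/eqP[_ -> _]|/IHp[lt_a ka]]; rewrite ?regK ?kindK ?leq_max //=.
- by rewrite leqnn.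
- by rewrite leqnn.
by rewrite lt_a orbT.
Qed.

Lemma odd_fresh p : odd (fresh p) = false.
Proof. by elim: p => [||p IHp q IHq|r p IHp] //=; rewrite !negbK ?oddD ?IHp ?IHq. Qed.

Lemma graph_src p s t n l a l' : (l, a, l') \in graph p s t n ->
  l = s \/ n <= l < n + fresh p /\ odd l = odd n.
Proof.
elim: p s t n => [j|j|p IHp q IHq|r p IHp] s t n /=.
- by rewrite inE => /eqP[-> _ _]; left.
- by rewrite inE => /eqP[-> _ _]; left.
- rewrite mem_cat => /orP[/IHp|/IHq] [->|]; [by left|..]; have := odd_fresh p; lia.
rewrite !inE => /or3P[/eqP[-> _ _]|/eqP[-> _ _]|/IHp[]]; [by left|by left|..]; lia.
Qed.

Lemma graph_dst p s t n l a l' : (l, a, l') \in graph p s t n ->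
  [\/ l' = s, l' = t | n <= l' < n + fresh p].
Proof.
elim: p s t n => [j|j|p IHp q IHq|r p IHp] s t n /=.
- by rewrite inE => /eqP[_ _ ->]; constructor 2.
- by rewrite inE => /eqP[_ _ ->]; constructor 2.
- by rewrite mem_cat => /orP[/IHp|/IHq] []; try (by constructor); constructor 3; lia.
by rewrite !inE => /or3P[/eqP[_ _ ->]|/eqP[_ _ ->]|/IHp[]]; try (by constructor); constructor 3; lia.
Qed.

(** Distinct compatible edges are a zero test and a decrement of one register, which are never
    enabled together. *)
Definition compat (e1 e2 : nat * nat) :=
  e1 = e2 \/ exists r, (e1.1 = tst r /\ e2.1 = dec r) \/ (e1.1 = dec r /\ e2.1 = tst r).

(** Since [s] lies below the inner nodes, [graph_src] shows that the two parts of a sequence leave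
    different nodes and that the body of a loop never leaves [s]. *)
Lemma graph_det p s t n l a1 l1 a2 l2 : s < n ->
  (l, a1, l1) \in graph p s t n -> (l, a2, l2) \in graph p s t n ->
  compat (a1, l1) (a2, l2).
Proof.
elim: p s t n => [j|j|p IHp q IHq|r p IHp] s t n lt_sn /=.
- by rewrite !inE => /eqP[_ -> ->] /eqP[_ -> ->]; left.
- by rewrite !inE => /eqP[_ -> ->] /eqP[_ -> ->]; left.
- rewrite !mem_cat => /orP[] e1 /orP[] e2.
  + by apply: IHp e1 e2; lia.
  + by case: (graph_src e1) => [|[+ _]]; case: (graph_src e2) => [|[+ _]]; lia.
  + by case: (graph_src e1) => [|[+ _]]; case: (graph_src e2) => [|[+ _]]; lia.
  by apply: IHq e1 e2; lia.
rewrite !inE => /or3P[/eqP E1|/eqP E1|e1] /or3P[/eqP E2|/eqP E2|e2];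
  try (case: E1 => *; subst); try (case: E2 => *; subst).
- by left.
- by right; exists r; left.
- by case: (graph_src e2) => [|[+ _]]; lia.
- by right; exists r; right.
- by left.
- by case: (graph_src e2) => [|[+ _]]; lia.
- by case: (graph_src e1) => [|[+ _]]; lia.
- by case: (graph_src e1) => [|[+ _]]; lia.
by apply: IHp e1 e2; lia.
Qed.

Section Determinism.
Variables (E : seq (nat * nat * nat)) (f : nat).
Hypothesis detE : forall l a1 l1 a2 l2, l <> f -> 0 < kind a1 -> 0 < kind a2 ->
  (l, a1, l1) \in E -> (l, a2, l2) \in E -> compat (a1, l1) (a2, l2).
Hypothesis absE : forall a l, (f, a, l) \in E -> l = f.

Lemma step_det c c1 c2 : c.1 <> f -> step E c c1 -> step E c c2 -> c1 = c2.
Proof.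
move=> neq_f S1 S2.
case: S1 neq_f S2 => l j l' v eE; [|move=> v1|move=> v1] => /= neq_f S2;
  inversion S2; subst; match goal with eE2 : is_true ((_, _, _) \in _) |- _ =>
    case: (detE neq_f _ _ eE eE2); rewrite ?kindK // end;
  rewrite /tst /dec /inc /cpy;
  do ?[case=> *; have ? : j = j0 by [lia]; subst => //; lia
      | case=> ? [] /= [] *; have ? : j = j0 by [lia]; subst => //; lia
      | move=> *; lia].
Qed.

(** Outside [f] the run is unique, and [f] is never left, so a run that blocks outside [f] rules out
    every run into [f]. *)
Lemma reach_stuck c c1 c2 : reach E c c1 -> reach E c c2 ->
  c1.1 <> f -> (forall c', ~ step E c1 c') -> c2.1 = f -> False.
Proof.
have absR d d' : reach E d d' -> d.1 = f -> d'.1 = f.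
  elim=> // d1 d2 d3 S _ IH d1f; apply: IH.
  by case: S d1f => l j l' v eE; [|move=> _|move=> _] => /= lf; apply: absE;
    rewrite lf in eE; exact: eE.
move=> R1; elim: R1 c2 => {c c1} [c|c c' c1 S1 R1 IH] c2 R2 c1f stuck c2f.
  by case: R2 c1f c2f stuck => // d1 d2 d3 S _ _ _ /(_ _ S).
case: R2 c2f S1 => [d df S1|d1 d2 d3 S2 R2 d3f S1].
  apply: c1f; apply: (absR _ _ R1).
  exact: absR (step_reach S1) df.
apply: (IH d3) => //; have [d1f|d1f] := eqVneq d1.1 f.
  by case: c1f; apply: (absR _ _ R1 (absR _ _ (step_reach S1) d1f)).
by rewrite (step_det _ S1 S2) //; apply/eqP.
Qed.

End Determinism.

(** * Timed encoding of registers *)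

Lemma unzip1_rcons S T (s : seq (S * T)) x : unzip1 (rcons s x) = rcons (unzip1 s) x.1.
Proof. exact: map_rcons. Qed.

(** The counter holds only the sum of the registers, so the test of a single register becomes [Noop]
    and its correctness is left to the timing. *)
Definition letter_op a : counter_op :=
  if kind a is 1 then Push else if kind a is 2 then Pop else Noop.

Fixpoint net_run (E : seq (nat * nat * nat)) l m (u : seq nat) l' : Prop :=
  if u is a :: u' then
    exists l1 m1, [/\ (l, a, l1) \in E, op_sem (letter_op a) m m1 & net_run E l1 m1 u' l']
  else l = l'.

Section Timed.
Variable R : realType.
Implicit Types (w : seq (nat * R)) (q : seq (R * nat)) (t d T : R) (j : nat).

Definition renewed d j w : bool :=
  has (fun e => ((e.1 == cpy j) || (e.1 == dec j)) && (e.2 == d)) w.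

Definition untested d j w : bool :=
  all (fun e => (e.1 == tst j) ==> (d <= e.2)%R) w.

(* The run of a counter program encoded by [w] is correct up to spurious events
   [cpy j] and [dec j]. *)
Fixpoint good w : bool :=
  if w is (a, t) :: w' then
    [&& (if w' is (_, t') :: _ then t' != t else true),
        (kind a <= 1) ==> renewed (t + 1)%R (reg a) w' && untested (t + 1)%R (reg a) w'
      & good w']
  else true.

Lemma good_path T w : good w -> path <=%R T (unzip2 w) ->
  (if w is (_, t') :: _ then t' != T else true) -> path <%R T (unzip2 w).
Proof.
elim: w T => [|[a t] w IHw] T //= /and3P[neq _ gw] /andP[le_Tt pw] neq_t.
by rewrite lt_neqAle eq_sym neq_t le_Tt /=; apply: IHw pw _.
Qed.

Lemma path_lt_all T w : path <%R T (unzip2 w) -> all (fun e => T < e.2)%R w.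
Proof.
move=> /(order_path_min lt_trans); rewrite all_map.
by apply: sub_all => -[].
Qed.

(* An element (d, j) of [q] stands for a live symbol of register [j] that has to
   be renewed at time [d]. *)
Definition pending q : nat -> nat := fun j => count (fun o => o.2 == j) q.

Definition serves w q := all (fun o => renewed o.1 o.2 w && untested o.1 o.2 w) q.

Lemma pending_rcons q o j : pending (rcons q o) j = pending q j + (o.2 == j).
Proof. by rewrite /pending -cats1 count_cat /= addn0. Qed.

(** The deadlines are distinct, so at most one falls due at [t], and then the event is its renewal.
    A zero test at [t] comes before the deadline of every pending symbol, which [untested] forbids
    for symbols of its own register. *)
Lemma serves_event a t w q : serves ((a, t) :: w) q -> all (fun e => t < e.2)%R w ->
  uniq (unzip1 q) ->
  [/\ serves w [seq o <- q | o.1 != t],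
      (kind a = 3 -> pending q (reg a) = 0)
    & [seq o <- q | o.1 != t] = q \/
      [/\ a = cpy (reg a) \/ a = dec (reg a),
          size q = (size [seq o <- q | o.1 != t]).+1
        & forall j, pending q j = (reg a == j) + pending [seq o <- q | o.1 != t] j]].
Proof.
move=> sq tw uq.
have none d j : renewed d j w -> (t < d)%R.
  by case/hasP=> -[b s] /(allP tw) /= lt_ts /andP[_ /eqP <-].
have sqP o : o \in q -> (o.1 = t /\ (a = cpy o.2 \/ a = dec o.2)) \/
    [/\ o.1 != t, renewed o.1 o.2 w, untested o.1 o.2 w & (a == tst o.2) ==> (o.1 <= t)%R].
  move=> /(allP sq) /= /andP[/orP[/andP[/orP[/eqP->|/eqP->] /eqP <-] _|rn /andP[ts un]]].
  - by left; split=> //; left.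
  - by left; split=> //; right.
  by right; split=> //; rewrite gt_eqF // (none _ _ rn).
split.
- apply/allP => o; rewrite mem_filter => /andP[neq_t /sqP[[E]|[_ -> -> //]]].
  by rewrite E eqxx in neq_t.
- move=> ka; apply/eqP; rewrite eqn0Ngt -has_count; apply/hasP => -[o /sqP oP /eqP oa].
  case: oP => [[_ []]|[_ rn _]]; rewrite oa.
  + by move=> E; move: ka; rewrite E kindK.
  + by move=> E; move: ka; rewrite E kindK.
  have -> : a = tst (reg a) by case: (letterP a) => // E; move: ka; rewrite {1}E kindK.
  by rewrite regK eqxx leNgt (none _ _ rn).
move: {sq} uq sqP; elim: q => [|o q IHq] /=; first by left.
move=> /andP[oq uq] sqP; case: eqP => [ot|/eqP ot] /=.
  have -> : [seq o <- q | o.1 != t] = q.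
    apply/all_filterP/allP => o' o'q; apply/eqP => E; move: oq.
    by rewrite ot -E; case/negP; apply: map_f.
  right; have [[_ oa]|[]] := sqP o (mem_head _ _); last by rewrite ot eqxx.
  have ra : reg a = o.2 by case: oa => ->; rewrite regK.
  by split=> // [|j]; rewrite ra.
have [o' o'q|E|[ca sz pq]] := IHq uq _; first by apply: sqP; rewrite inE o'q orbT.
  by left; rewrite E.
by right; split=> // [|j]; rewrite ?sz // /pending /= -/(pending _ _) pq addnCA.
Qed.

Lemma serves_rcons w q o : serves w (rcons q o) =
  serves w q && (renewed o.1 o.2 w && untested o.1 o.2 w).
Proof. by rewrite /serves all_rcons andbC. Qed.

(* [size q - m] never decreases, grows at each spurious event, and is at most 0
   at the end of the word, where nothing is pending. *)
Lemma net_run_reach E w l m l' q T :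
  (forall l a l1, (l, a, l1) \in E -> kind a = 0 -> l1 = l) ->
  path <%R T (unzip2 w) -> good w -> serves w q -> uniq (unzip1 q) ->
  all (fun o => o.1 <= T + 1)%R q -> net_run E l m (unzip1 w) l' ->
  size q <= m /\ (m = size q -> reach E (l, pending q) (l', fun=> 0)).
Proof.
move=> loopE; elim: w l m q T => [|[a t] w IHw] l m q T /=.
  move=> _ _ + _ _ <-; case: q => //= _; split=> // _.
  by rewrite (_ : pending [::] = fun=> 0) //; exact: ReachRefl.
move=> /andP[lt_Tt pw] /and3P[_ gaw gw] sq uq le_q [l1 [m1 [eE opm rw]]].
have tw := path_lt_all pw.
have [sq1 zq qE] := serves_event sq tw uq.
set q1 := [seq o <- q | o.1 != t] in sq1 qE.
have uq1 : uniq (unzip1 q1).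
  by apply: subseq_uniq uq; apply/map_subseq/filter_subseq.
have le_q1 : all (fun o => o.1 <= t + 1)%R q1.
  apply/allP => o; rewrite mem_filter => /andP[_ /(allP le_q)]; lra.
case: (letterP a) gaw opm eE qE zq; set j := reg a => ->; rewrite /letter_op !kindK /= => gaw opm eE qE zq.
- have {}gaw : serves w (rcons q1 ((t + 1)%R, j)) by rewrite serves_rcons sq1.
  have := IHw l1 m1 (rcons q1 ((t + 1)%R, j)) t pw gw gaw _ _ rw.
  rewrite all_rcons /= lexx le_q1 unzip1_rcons rcons_uniq uq1 andbT.
  (* All older deadlines are at most [T + 1], hence less than [t + 1]. *)
  have -> : (t + 1)%R \notin unzip1 q1.
    apply/negP => /mapP[o]; rewrite mem_filter => /andP[_ /(allP le_q)] /= + tE; lra.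
  rewrite size_rcons => /(_ isT isT)[le_m1 reach1].
  have m1E : m1 = m by apply/eqP.
  have l1E : l1 = l by apply: loopE eE _; rewrite kindK.
  rewrite m1E in le_m1 reach1.
  (* If the copy renews nothing, it adds a pending symbol without a push, so [size q < m] and
     equality is excluded. *)
  case: qE => [q1E|[_ sz pq]].
    by rewrite q1E in le_m1; split=> [|E1]; [exact: ltnW | rewrite E1 ltnn in le_m1].
  rewrite -sz in le_m1 reach1; split=> // E1.
  rewrite -l1E; have -> : pending q = pending (rcons q1 ((t + 1)%R, j)).
    by apply/funext=> i; rewrite pending_rcons pq addnC.
  exact: reach1.
- have {}gaw : serves w (rcons q1 ((t + 1)%R, j)) by rewrite serves_rcons sq1.
  have := IHw l1 m1 (rcons q1 ((t + 1)%R, j)) t pw gw gaw _ _ rw.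
  rewrite all_rcons /= lexx le_q1 unzip1_rcons rcons_uniq uq1 andbT.
  have -> : (t + 1)%R \notin unzip1 q1.
    apply/negP => /mapP[o]; rewrite mem_filter => /andP[_ /(allP le_q)] /= + tE; lra.
  rewrite size_rcons => /(_ isT isT)[le_m1 reach1].
  have m1E : m1 = m.+1 by apply/eqP.
  rewrite m1E in le_m1 reach1.
  case: qE => [q1E|[+ _ _]]; last by case=> /(congr1 kind); rewrite !kindK.
  rewrite q1E in le_m1 reach1; split=> [//|E1].
  apply: ReachStep (StepInc _ eE) _.
  have -> : upd (pending q) j (pending q j).+1 = pending (rcons q ((t + 1)%R, j)).
    apply/funext=> i; rewrite pending_rcons /upd /= eq_sym.
    by case: eqP => [->|_]; rewrite ?addn1 ?addn0.
  by apply: reach1; rewrite E1.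
- have [le_m1 reach1] := IHw l1 m1 q1 t pw gw sq1 uq1 le_q1 rw.
  have [m_gt0 m1E] : 0 < m /\ m1 = m.-1 by case/andP: opm => ? /eqP.
  have {}m1E : m = m1.+1 by rewrite m1E prednK.
  (* If the decrement consumes nothing, only the counter drops, and again [size q < m]. *)
  rewrite m1E; case: qE => [q1E|[_ sz pq]].
    by rewrite q1E in le_m1; split=> [|E1]; [exact: leqW | rewrite -E1 ltnn in le_m1].
  rewrite sz; split=> // -[E1]; have pqj := pq j; rewrite eqxx in pqj.
  apply: ReachStep (StepDec eE _) _; first by rewrite pqj.
  have -> : upd (pending q) j (pending q j).-1 = pending q1.
    apply/funext=> i; rewrite /upd; case: eqP => [->|neq]; first by rewrite pqj.
    by rewrite pq; case: eqP => // ij; case: neq.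
  exact: reach1.
have [le_m1 reach1] := IHw l1 m1 q1 t pw gw sq1 uq1 le_q1 rw.
have m1E : m1 = m by apply/eqP.
rewrite m1E in le_m1 reach1.
case: qE => [q1E|[+ _ _]]; last by case=> /(congr1 kind); rewrite !kindK.
rewrite q1E in le_m1 reach1; split=> // E1.
by apply: ReachStep (StepTst eE _) (reach1 E1); apply: zq.
Qed.

(** * From program runs to timed words *)

Definition queue_at q T :=
  pairwise <%R (unzip1 q) && all (fun o => T < o.1 <= T + 1)%R q.

(** Density of the reals leaves room for an event before the first deadline. *)
Lemma queue_at_time q T : queue_at q T ->
  exists2 t, (T < t)%R & all (fun o => t < o.1)%R q.
Proof.
case: q => [|[d j] q] /andP[/= sq aq].
  by exists (T + 1)%R => //; lra.
exists ((T + d) / 2)%R; first by lra.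
apply/andP; split=> /=; first by lra.
by move: sq => /andP[+ _]; rewrite all_map; apply: sub_all => o /=; lra.
Qed.

Lemma queue_at_shift q T t : queue_at q T -> (T < t)%R ->
  all (fun o => t < o.1)%R q -> queue_at q t.
Proof.
move=> /andP[sq aq] Tt tq; rewrite /queue_at sq /=; apply/allP=> o oq.
by have := allP tq _ oq; have := allP aq _ oq => /=; lra.
Qed.

(** A symbol created at [t] is due after every older one, so appending it keeps the queue ordered by
    deadline. *)
Lemma queue_at_rcons q T t j : queue_at q T -> (T < t)%R ->
  all (fun o => t < o.1)%R q -> queue_at (rcons q ((t + 1)%R, j)) t.
Proof.
move=> qT Tt tq; have /andP[sq aq] := queue_at_shift qT Tt tq.
rewrite /queue_at unzip1_rcons pairwise_rcons all_rcons sq aq /= !andbT.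
apply/andP; split; last by lra.
rewrite all_map; apply/allP=> o oq; have /andP[_ aT] := qT.
by have := allP aT _ oq => /=; lra.
Qed.

Lemma serves_cons a t w q : serves w q -> (forall j, a = tst j -> pending q j = 0) ->
  serves ((a, t) :: w) q.
Proof.
move=> sw za; apply/allP => o oq; have /andP[rn un] := allP sw _ oq.
rewrite /renewed /= [X in _ || X]rn orbT /untested /= [X in _ && X]un andbT.
apply/implyP => /eqP /za /eqP; rewrite eqn0Ngt -has_count => /hasPn /(_ _ oq).
by rewrite eqxx.
Qed.

Section Completeness.
Variables (E : seq (nat * nat * nat)) (K l' : nat).
Hypothesis regE : forall l a l1, (l, a, l1) \in E -> reg a < K.
Hypothesis cpyE : forall l j i l1, (l, dec j, l1) \in E -> i < K -> (l, cpy i, l) \in E.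

Definition completes l q T := exists w,
  [/\ net_run E l (size q) (unzip1 w) l', path <%R T (unzip2 w), good w & serves w q].

Lemma good_cons a t w : path <%R t (unzip2 w) ->
  (kind a <= 1 -> renewed (t + 1)%R (reg a) w /\ untested (t + 1)%R (reg a) w) ->
  good w -> good ((a, t) :: w).
Proof.
move=> pw ga gw /=; rewrite gw andbT; apply/andP; split.
  by case: w pw {ga gw} => //= -[b s] w /andP[lt_ts _]; rewrite gt_eqF.
by apply/implyP => /ga[-> ->].
Qed.

(* Copies are replayed in the order of their deadlines until the turn of one
   of register [j]. *)
Lemma completes_dec l l1 j q T : (l, dec j, l1) \in E -> queue_at q T ->
  all (fun o => o.2 < K) q -> 0 < pending q j ->
  (forall q' T', queue_at q' T' -> all (fun o => o.2 < K) q' ->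
     pending q' = upd (pending q) j (pending q j).-1 -> completes l1 q' T') ->
  completes l q T.
Proof.
(* Each copy moves the head of the queue to its end, so the position of the first symbol of [j]
   decreases. *)
move=> eE; have [n le_n] := ubnP (find (fun o => o.2 == j) q).
elim: n q T le_n => // n IHn [|[d i] q] T //= le_n qT /andP[lt_iK lt_qK] pj compl.
have [Td q_lt qd] : [/\ (T < d)%R, all (fun o => d < o.1)%R q & queue_at q T].
  move: qT; rewrite /queue_at /= all_map => /andP[/andP[dq ->] /andP[/andP[Td _] ->]].
  by split.
(* If the symbol due first belongs to [j], the decrement takes the place of its renewal. *)
case: eqVneq le_n => [E1|neq_ij] le_n.
  have [|w [rw pw gw sw]] := compl q d (queue_at_shift qd Td q_lt) lt_qK.
    apply/funext => r; rewrite /upd /pending /= -/(pending q r) -/(pending q j) E1 eqxx.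
    by rewrite eq_sym; case: eqP => [->|].
  exists ((dec j, d) :: w); split=> /=.
  - exists l1, (size q); split=> //.
    by rewrite /letter_op kindK /= eqxx.
  - by rewrite Td.
  - by apply: good_cons => //; rewrite kindK.
  apply/andP; split.
    rewrite /= /renewed /untested /= E1 !eqxx !orbT /=; apply/andP; split.
      by apply/implyP => /eqP /(congr1 kind); rewrite !kindK.
    by apply: sub_all (path_lt_all pw) => e ?; apply/implyP => _; exact: ltW.
  by apply: serves_cons => // r /(congr1 kind); rewrite !kindK.
have qr := queue_at_rcons i qd Td q_lt.
have pE : pending (rcons q ((d + 1)%R, i)) = pending ((d, i) :: q).
  by apply/funext => r; rewrite pending_rcons /pending /= addnC.
have [||||w [rw pw gw sw]] := IHn (rcons q ((d + 1)%R, i)) d _ qr _ _ _.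
- have hj : has (fun o => o.2 == j) q.
    by rewrite has_count; move: pj; rewrite /pending /= (negPf neq_ij).
  by rewrite -cats1 find_cat hj.
- by rewrite all_rcons lt_iK.
- by rewrite pE.
- by rewrite pE.
move: sw; rewrite serves_rcons => /andP[sw /andP[rn un]].
exists ((cpy i, d) :: w); split=> /=.
- exists l, (size q).+1; split=> //; first exact: cpyE eE lt_iK.
    by rewrite /letter_op kindK /=.
  by rewrite size_rcons in rw.
- by rewrite Td.
- by apply: good_cons => // _; rewrite regK.
apply/andP; split.
  rewrite /= /renewed /untested /= !eqxx /=; apply/andP; split.
    by apply/implyP => /eqP /(congr1 kind); rewrite !kindK.
  by apply: sub_all (path_lt_all pw) => e ?; apply/implyP => _; exact: ltW.
by apply: serves_cons => // r /(congr1 kind); rewrite !kindK.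
Qed.

(** Converse of [net_run_reach]: increments and tests are placed before the first deadline, while a
    decrement waits for the deadline of a symbol of its register. *)
Lemma reach_completes c c' : reach E c c' -> c' = (l', fun=> 0) ->
  forall q T, pending q = c.2 -> queue_at q T -> all (fun o => o.2 < K) q ->
  completes c.1 q T.
Proof.
elim=> {c c'} [c ->|c c1 c' S _ IH c'E] q T pq qT lt_qK.
  exists [::]; split=> //=; case: q pq {qT lt_qK} => // o q /(congr1 (fun v => v o.2)).
  by rewrite /pending /= eqxx.
have {IH} := IH c'E; case: S pq => l j l1 v eE => [pq|v_gt0 pq|v0 pq] /= IH.
- have [t Tt tq] := queue_at_time qT.
  have [||w [rw pw gw sw]] := IH (rcons q ((t + 1)%R, j)) t _ (queue_at_rcons j qT Tt tq).
  + by apply/funext => i; rewrite pending_rcons pq /upd /= eq_sym; case: eqP => [->|_]; rewrite ?addn1 ?addn0.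
  + by rewrite all_rcons lt_qK -[j](regK j).1.1.2 (regE eE).
  move: sw; rewrite serves_rcons => /andP[sw /andP[rn un]].
  exists ((inc j, t) :: w); split=> /=.
  + by exists l1, (size q).+1; split=> //; [rewrite /letter_op kindK /= | rewrite size_rcons in rw].
  + by rewrite Tt.
  + by apply: good_cons => // _; rewrite regK.
  by apply: serves_cons => // r /(congr1 kind); rewrite !kindK.
- rewrite /= in pq; apply: (completes_dec eE qT lt_qK); first by rewrite pq.
  by rewrite pq => q' T' qT' lt_q' pq'; apply: IH.
have [t Tt tq] := queue_at_time qT.
have [//|w [rw pw gw sw]] := IH q t pq (queue_at_shift qT Tt tq).
exists ((tst j, t) :: w); split=> /=.
- by exists l1, (size q); split=> //; rewrite /letter_op kindK /=.
- by rewrite Tt.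
- by apply: good_cons => //; rewrite kindK.
by apply: serves_cons => // r /(congr1 reg); rewrite !regK pq => <-.
Qed.

End Completeness.
End Timed.

(** * From automata to untyped runs *)

Section AbsoluteTime.
Variables (R : realType) (Sg L X : finType) (A : toca Sg L X).
Implicit Types (T : R) (w : seq (Sg * R)).

(** Words carry absolute times and transitions carry delays; [T] is the time of the previous
    event. *)
Fixpoint timed_run T (s : state R L X) w s' : Prop :=
  if w is (a, t) :: w' then
    exists2 s1, transition A s a (t - T)%R s1 & timed_run t s1 w' s'
  else s = s'.

Fixpoint delays T w : seq (Sg * R) :=
  if w is (a, t) :: w' then (a, (t - T)%R) :: delays t w' else [::].

Lemma languageP w : language R A w <-> timed_word w /\
  exists s s', [/\ initial_state A s, timed_run 0%R s w s' & s'.1.1 \in accepting A].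
Proof.
split=> -[tw].
  move=> [s [r [s' [[si rr s'a] wE]]]]; split=> //; exists s, s'; split=> //.
  rewrite wE /associated_word; elim: r (0%R : R) s rr {si tw wE} => [//|[a d] r IHr] T s /=.
  by move=> [s1 ss1 rr]; exists s1; [rewrite addrAC subrr add0r | exact: IHr].
move=> [s [s' [si rw s'a]]]; split=> //; exists s, (delays 0%R w), s'; split.
  split=> //; elim: w (0%R : R) s rw {si tw} => [//|[a t] w IHw] T s /= [s1 ss1 rw].
  by exists s1 => //; apply: IHw.
rewrite /associated_word; elim: w (0%R : R) {tw rw} => [//|[a t] w IHw] T /=.
by rewrite addrC subrK -IHw.
Qed.

End AbsoluteTime.

Section Erasure.
Variables (R : realType) (k : nat).
Implicit Types (T : R) (w : seq ('I_k * R)).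

Definition erase w : seq (nat * R) := [seq (nat_of_ord e.1, e.2) | e <- w].

Lemma unzip2_erase w : unzip2 (erase w) = unzip2 w.
Proof. by rewrite /unzip2 -map_comp. Qed.

End Erasure.

(** * Nets from lists of numbered edges *)

Section Net.
Variables (R : realType) (k N : nat) (E : seq (nat * nat * nat)).

Definition net_edge (e : nat * nat * nat) : edge 'I_k.+1 'I_N.+1 'I_0 :=
  Edge (inord e.1.1) (inord e.1.2) [::] (letter_op e.1.2) finset.set0 (inord e.2).

Definition net : toca 'I_k.+1 'I_N.+1 'I_0 :=
  Toca (finset.set1 ord_max) (finset.set1 ord0) (map net_edge E).

Hypothesis ltE : forall e, e \in E -> [/\ e.1.1 <= N, e.1.2 <= k & e.2 <= N].

Lemma mem_net e : e \in edges net -> exists l a l1,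
  [/\ (l, a, l1) \in E, e = net_edge (l, a, l1),
      src e = l :> nat, lbl e = a :> nat & dst e = l1 :> nat].
Proof.
case/mapP => -[[l a] l1] eE ->; exists l, a, l1; have /= [lN ak l1N] := ltE eE.
by split=> //=; rewrite inordK.
Qed.

Lemma timed_run_net T (s s' : state R _ _) w : timed_run net T s w s' ->
  net_run E s.1.1 s.2 (unzip1 (erase w)) s'.1.1.
Proof.
elim: w T s => [|[a t] w IHw] T [[l nu] m] /=; first by move=> <-.
case=> -[[l1 nu1] m1] [_ [e [eE [sE aE dE] _ _ opm]]] /IHw rw.
have [l2 [a2 [l3 [e2E eE2 src2 lbl2 dst2]]]] := mem_net eE.
exists l1, m1; split=> //; first by rewrite -sE -aE -dE src2 lbl2 dst2.
by rewrite -aE lbl2; rewrite eE2 in opm.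
Qed.

Lemma net_timed_run T l (nu : {ffun 'I_0 -> R}) m w l' :
  path <=%R T (unzip2 w) -> net_run E (nat_of_ord l) m (unzip1 (erase w)) l' ->
  exists s', timed_run net T (l, nu, m) w s' /\ s'.1.1 = l' :> nat.
Proof.
elim: w T l nu m => [|[a t] w IHw] T l nu m /=; first by move=> _ <-; exists (l, nu, m).
case/andP => Tt pw [l1 [m1 [eE opm rw]]]; have /= [_ _ l1N] := ltE eE.
have [//|s' [rs' s'l]] := IHw t (inord l1) (reset_clocks (delay nu (t - T)) finset.set0) m1 pw.
  by rewrite inordK.
exists s'; split=> //; eexists; last exact: rs'.
split; first by rewrite subr_ge0.
exists (net_edge (nat_of_ord l, nat_of_ord a, l1)); split=> //=; first exact: map_f.
by rewrite !inord_val.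
Qed.

End Net.

(** * One-clock automata from lists of numbered edges *)

Section Monitor.
Variables (R : realType) (k N : nat) (F : seq (nat * nat * seq (cmp * nat) * bool * nat)).
Implicit Types (T t : R).

Definition monitor_edge (e : nat * nat * seq (cmp * nat) * bool * nat) :
    edge 'I_k.+1 'I_N.+1 'I_1 :=
  let: (s, a, g, z, d) := e in
  Edge (inord s) (inord a) [seq (ord0, c.1, c.2) | c <- g] Noop
    (if z then finset.setTfor 'I_1 else finset.set0) (inord d).

Definition monitor : toca 'I_k.+1 'I_N.+1 'I_1 :=
  Toca (finset.set1 ord0) [set l | odd (nat_of_ord l)]%SET (map monitor_edge F).

Hypothesis ltF : forall s a g z d, (s, a, g, z, d) \in F -> [/\ s <= N, a <= k & d <= N].

Fact elapsed_since T t (n : R) : (t - (T - n) = n + (t - T))%R.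
Proof. by rewrite opprB addrCA. Qed.

Fact last_reset T t (n : R) : (t - (n + (t - T)) = T - n)%R.
Proof. by ring. Qed.

(** [tau] is the time of the last reset, so that the clock shows [t - tau] at time [t]. *)
Fixpoint monitor_run s (tau : R) (w : seq (nat * R)) s' : Prop :=
  if w is (a, t) :: w' then
    exists g z s1, [/\ (s, a, g, z, s1) \in F,
      all (fun c => cmp_sem c.1 (t - tau)%R c.2%:R) g
      & monitor_run s1 (if z then t else tau) w' s']
  else s = s'.

Lemma timed_run_monitor T (s s' : state R _ _) w : timed_run monitor T s w s' ->
  monitor_run s.1.1 (T - s.1.2 ord0) (erase w) s'.1.1.
Proof.
elim: w T s => [|[a t] w IHw] T [[l nu] m] /=; first by move=> <-.
case=> -[[l1 nu1] m1] [_ [e [/mapP[[[[[s0 a0] g] z] d] eF eE] [sE aE dE] gE nuE _]]] /IHw rw.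
have [sN ak dN] := ltF eF; rewrite eE /= in sE aE dE gE nuE.
exists g, z, l1; split.
- by rewrite -sE -aE -dE !inordK.
- move: gE; rewrite /satisfies all_map; apply: sub_all => c /=.
  by rewrite ffunE elapsed_since.
move: rw; rewrite /= nuE !ffunE; case: (z); rewrite ?finset.in_setT ?finset.in_set0 ?subr0 //.
by rewrite last_reset.
Qed.

Lemma monitor_timed_run T l (nu : {ffun 'I_1 -> R}) m w l' :
  path <=%R T (unzip2 w) -> monitor_run (nat_of_ord l) (T - nu ord0)%R (erase w) l' ->
  exists s', timed_run monitor T (l, nu, m) w s' /\ s'.1.1 = l' :> nat.
Proof.
elim: w T l nu m => [|[a t] w IHw] T l nu m /=; first by move=> _ <-; exists (l, nu, m).
case/andP => Tt pw [g [z [l1 [eF gE rw]]]]; have [_ _ l1N] := ltF eF.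
pose nu1 := reset_clocks (delay nu (t - T)) (if z then finset.setTfor 'I_1 else finset.set0).
have [|s' [rs' s'l]] := IHw t (inord l1) nu1 m pw.
  rewrite inordK //; move: rw; rewrite /nu1 !ffunE.
  case: (z); rewrite ?finset.in_setT ?finset.in_set0 ?subr0 //.
  by rewrite last_reset.
exists s'; split=> //; eexists; last exact: rs'.
split; first by rewrite subr_ge0.
exists (monitor_edge (nat_of_ord l, nat_of_ord a, g, z, l1)); split=> //.
- exact: (map_f monitor_edge eF).
- by rewrite /= !inord_val.
- rewrite /satisfies all_map; apply: sub_all gE => c /=.
  by rewrite ffunE elapsed_since.
exact: eqxx.
Qed.

End Monitor.

Section Patterns.
Variables (R : realType) (K : nat).
Implicit Types (tau t : R) (w : seq (nat * R)).

(* Location 0 guesses the event at which [good] fails; 2 looks for a second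
   event at the same time, 3 + 2j for a missing renewal of a symbol of register
   [j], 4 + 2j for a zero test of [j] within one time unit, 1 is the sink.  The
   accepting locations are the odd ones. *)
Definition pattern (e : nat * nat * seq (cmp * nat) * bool * nat) : bool :=
  let: (s, a, g, z, d) := e in
  match s with
  | 0 => (g == [::]) &&
         [|| ~~ z && (d == 0), z && (d == 2)
           | [&& z, kind a <= 1 & (d == (reg a).*2.+3) || (d == (reg a).*2.+4)]]
  | 1 => [&& g == [::], ~~ z & d == 1]
  | 2 => [&& g == [:: (CEq, 0)], ~~ z & d == 1]
  | s'.+3 =>
      ~~ z &&
      if odd s' then
        (g == [::]) && (d == s) || [&& g == [:: (CLt, 1)], a == tst s'./2 & d == 1]
      else
        (d == s) && [|| g == [:: (CLt, 1)], g == [:: (CGt, 1)]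
          | [&& g == [::], a != cpy s'./2 & a != dec s'./2]]
  end.

Definition pairs S T (s : seq S) (t : seq T) := [seq (x, y) | x <- s, y <- t].

Lemma mem_pairs (S T : eqType) (s : seq S) (t : seq T) x y :
  ((x, y) \in pairs s t) = (x \in s) && (y \in t).
Proof.
apply/allpairsP/andP => [[[x' y'] /= [xs yt [-> ->]]] // | [xs yt]].
by exists (x, y).
Qed.

Definition patterns :=
  [seq e <- pairs (pairs (pairs (pairs (iota 0 K.*2.+3) (iota 0 (4 * K)))
     [:: [::]; [:: (CLt, 1)]; [:: (CEq, 0)]; [:: (CGt, 1)]]) [:: false; true])
     (iota 0 K.*2.+3) | pattern e].

Lemma mem_patterns s a g z d : ((s, a, g, z, d) \in patterns) =
  [&& pattern (s, a, g, z, d), s < K.*2.+3, a < 4 * K, d < K.*2.+3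
    & g \in [:: [::]; [:: (CLt, 1)]; [:: (CEq, 0)]; [:: (CGt, 1)]]].
Proof.
rewrite mem_filter !mem_pairs !mem_iota !add0n !leq0n /=; congr (_ && _).
have -> : z \in [:: false; true] by case: z.
by rewrite andbT -!andbA; do 2 congr (_ && _); rewrite andbC.
Qed.

Definition accepts s tau w := exists s', odd s' /\ monitor_run patterns s tau w s'.

Lemma accepts_cons s tau a t w : accepts s tau ((a, t) :: w) <->
  exists g z d, [/\ (s, a, g, z, d) \in patterns,
    all (fun c => cmp_sem c.1 (t - tau)%R c.2%:R) g & accepts d (if z then t else tau) w].
Proof.
split=> [[s' [odds' /= [g [z [d [eP gP rw]]]]]]|[g [z [d [eP gP [s' [odds' rw]]]]]]].
  by exists g, z, d; split=> //; exists s'.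
by exists s'; split=> //; exists g, z, d.
Qed.

Definition letters_lt w := all (fun e => e.1 < 4 * K) w.

Lemma accepts_sink tau w : letters_lt w -> accepts 1 tau w.
Proof.
elim: w => [|[a t] w IHw] /=; first by exists 1.
case/andP=> aK wK; apply/accepts_cons; exists [::], false, 1; split=> //; last exact: IHw.
by rewrite mem_patterns aK !inE //= ?ltnS.
Qed.

Lemma accepts_same_time tau w : letters_lt w ->
  accepts 2 tau w <-> (if w is (_, t) :: _ then t == tau else false).
Proof.
case: w => [|[a t] w] /= wK; first by split=> // -[s' [+ E]]; rewrite -E.
have /andP[/= aK wK'] := wK; split=> [/accepts_cons[g [z [d []]]]|/eqP->].
  rewrite mem_patterns => /andP[/and3P[/eqP-> _ _] _] /=.
  by rewrite andbT subr_eq0.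
apply/accepts_cons; exists [:: (CEq, 0)], false, 1; split; last exact: accepts_sink.
  by rewrite mem_patterns aK !inE //= ?ltnS.
by rewrite /= subrr eqxx.
Qed.

(** The location is accepting, and its only edges are loops that let pass every event but a renewal
    of [j] exactly one time unit after [tau]. *)
Lemma accepts_renewal j tau w : j < K -> letters_lt w ->
  accepts j.*2.+3 tau w <-> ~~ renewed (tau + 1)%R j w.
Proof.
move=> jK; elim: w => [|[a t] w IHw] /=.
  by move=> _; split=> // _; exists j.*2.+3; rewrite /= odd_double.
have jK2 : j.*2.+3 < K.*2.+3 by rewrite !ltnS ltn_double.
case/andP=> aK /IHw{}IHw; rewrite -/(renewed _ j w) negb_or.
split=> [/accepts_cons[g [z [d []]]]|/andP[na /IHw rw]].
  rewrite mem_patterns /= odd_double doubleK /=.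
  move=> /andP[/andP[/negPf -> /andP[/eqP -> gE] _]] /= gP /IHw->; rewrite andbT.
  rewrite -negb_or in gE; case/or3P: gE gP => [/eqP->|/eqP->|/andP[_ /negPf-> //]] /=.
    by rewrite andbT ltrBlDl => /lt_eqF->; rewrite andbF.
  by rewrite andbT ltrBrDl => /gt_eqF->; rewrite andbF.
apply/accepts_cons.
have [tE|tE] := eqVneq t (tau + 1)%R.
  exists [::], false, j.*2.+3; split=> //.
  rewrite mem_patterns /= odd_double ?doubleK /= aK jK2 !inE /= eqxx /= andbT.
  by move: na; rewrite tE eqxx andbT negb_or.
case: (ltrgtP t (tau + 1)%R) tE => // lt_t _.
  exists [:: (CLt, 1)], false, j.*2.+3; split=> //; last by rewrite /= andbT ltrBlDl.
  by rewrite mem_patterns /= odd_double ?doubleK /= aK jK2 !inE /= eqxx.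
exists [:: (CGt, 1)], false, j.*2.+3; split=> //; last by rewrite /= andbT ltrBrDl.
by rewrite mem_patterns /= odd_double ?doubleK /= aK jK2 !inE /= eqxx.
Qed.

(** The location is not accepting, so the sink has to be reached, by a letter [tst j] less than one
    time unit after [tau]. *)
Lemma accepts_zero_test j tau w : j < K -> letters_lt w ->
  accepts j.*2.+4 tau w <-> ~~ untested (tau + 1)%R j w.
Proof.
move=> jK; elim: w => [|[a t] w IHw] /=.
  by move=> _; split=> // -[s' [+ E]]; rewrite -E /= odd_double.
have jK2 : j.*2.+4 < K.*2.+3 by rewrite !ltnS ltn_Sdouble.
case/andP=> aK /[dup] wK /IHw{}IHw; rewrite -/(untested _ j w) negb_and.
split=> [/accepts_cons[g [z [d []]]]|].
  rewrite mem_patterns /= odd_double /= uphalf_double.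
  move=> /andP[/andP[/negPf -> /orP[/andP[_ /eqP->]|/and3P[/eqP-> -> _]]] _] /=.
    by move=> _ /IHw->; rewrite orbT.
  by rewrite andbT ltrBlDl -ltNge => ->.
case/orP=> [nt|/IHw acc]; apply/accepts_cons.
  move: nt; rewrite negb_imply -ltNge => /andP[/eqP aE lt1].
  exists [:: (CLt, 1)], false, 1; split; last exact: accepts_sink.
    by rewrite mem_patterns /= odd_double /= uphalf_double aK jK2 aE !inE eqxx.
  by rewrite /= andbT ltrBlDl.
exists [::], false, j.*2.+4; split=> //.
by rewrite mem_patterns /= odd_double /= ?uphalf_double aK jK2 !inE /= eqxx.
Qed.

(** The edge that makes the guess resets the clock, so [tau] becomes the time of the guessed
    event. *)
Lemma accepts_bad tau w : letters_lt w -> accepts 0 tau w <-> ~~ good w.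
Proof.
elim: w tau => [|[a t] w IHw] tau; first by split=> // -[s' [+ E]]; rewrite -E.
move=> /andP[aK wK]; have ra : reg a < K by rewrite /reg ltn_divLR // mulnC.
have ra2 : (reg a).*2.+3 < K.*2.+3 by rewrite !ltnS ltn_double.
split=> [/accepts_cons[g [z [d []]]]|].
  rewrite mem_patterns => /andP[/andP[_ dP] _] _ acc; apply/negP => /and3P[neq ga gw].
  case/or3P: dP acc => [/andP[/negPf-> /eqP->]|/andP[-> /eqP->]|/and3P[-> ka]].
  - by move/(IHw _ wK)/negP; apply.
  - by move/accepts_same_time => /(_ wK); case: (w) neq => // -[b s] w' /= /negPf->.
  move: ga; rewrite ka => /andP[rn un] /orP[/eqP->|/eqP->].
    by move/accepts_renewal => /(_ ra wK); rewrite rn.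
  by move/accepts_zero_test => /(_ ra wK); rewrite un.
move=> nb; apply/accepts_cons.
have [gw|] := boolP (good w); last first.
  by move=> /(IHw tau wK).2; exists [::], false, 0; split=> //; rewrite mem_patterns aK !inE.
move: nb; rewrite /= gw andbT negb_and negb_imply => /orP[|/andP[ka]].
  move=> neq; exists [::], true, 2; split=> //; first by rewrite mem_patterns aK !inE //= ?ltnS.
  by apply/accepts_same_time => //; case: (w) neq => // -[b s] w'; rewrite negbK.
rewrite negb_and => /orP[|] nrn.
  exists [::], true, (reg a).*2.+3; split=> //; last exact/accepts_renewal.
  by rewrite mem_patterns /= ka aK ra2 !inE eqxx ?orbT.
exists [::], true, (reg a).*2.+4; split=> //; last exact/accepts_zero_test.
by rewrite mem_patterns /= ka aK !inE eqxx ?orbT /= !ltnS ltn_Sdouble ra.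
Qed.

End Patterns.

(** * The instance of a program *)

Section NetEdges.
Variables (p : prog) (K a b : nat).
(** The range of [l] covers every location that a decrement leaves, which is where copies are
    replayed. *)
Definition copies : seq (nat * nat * nat) :=
  [seq (l, cpy j, l) | l <- iota 0 (fresh p).+2, j <- iota 0 K].

(** The program may halt with nonzero registers; their symbols are consumed at the final location
    0. *)
Definition drains : seq (nat * nat * nat) := [seq (0, dec j, 0) | j <- iota 0 K].

(** Independent of [a] and [b], so that the code of this list can be taken as [a]. *)
Definition template := graph p 1 0 2 ++ copies ++ drains.

(* Loads [b] into register 1 and then [a] into register 0; descends through the
   odd locations to 1, where [p] starts. *)
Definition loader : seq (nat * nat * nat) :=
  mkseq (fun i => (i.*2.+3, inc (a <= i), i.*2.+1)) (a + b).

Definition net_edges := loader ++ template.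

(** Both the initial location and the largest one, hence [ord_max] in [net]. *)
Definition entry := (a + b).*2.+1.

Lemma mem_net_edges e : (e \in net_edges) =
  [|| e \in loader, e \in graph p 1 0 2, e \in copies | e \in drains].
Proof. by rewrite mem_cat [e \in template]mem_cat [e \in copies ++ drains]mem_cat. Qed.

Inductive net_edge_spec l x l1 : Prop :=
| LoaderEdge i of i < a + b & l = i.*2.+3 & x = inc (a <= i) & l1 = i.*2.+1
| GraphEdge of (l, x, l1) \in graph p 1 0 2
| CopyEdge j of j < K & l < (fresh p).+2 & x = cpy j & l1 = l
| DrainEdge j of j < K & l = 0 & x = dec j & l1 = 0.

Lemma net_edgesP l x l1 : (l, x, l1) \in net_edges -> net_edge_spec l x l1.
Proof.
rewrite mem_net_edges => /or4P[/mapP[i]|xE|/allpairsPdep[l0 [j []]]|/mapP[j]].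
- by rewrite mem_iota => lt_i [-> -> ->]; apply: LoaderEdge lt_i _ _ _.
- exact: GraphEdge.
- rewrite !mem_iota => lt_l lt_j [-> -> ->].
  by apply: CopyEdge lt_j _ _ _.
by rewrite mem_iota => lt_j [-> -> ->]; apply: DrainEdge lt_j _ _ _.
Qed.

Lemma graph_net_edges : {subset graph p 1 0 2 <= net_edges}.
Proof. by move=> e eE; rewrite mem_net_edges eE orbT. Qed.

Lemma net_edges_reg l x l1 : 1 < K -> regs p <= K -> (l, x, l1) \in net_edges -> reg x < K.
Proof.
move=> K_gt1 regs_p; case/net_edgesP => [i _ _ -> _|/graph_letter[+ _]|j + _ -> _|j + _ -> _].
- by rewrite regK; apply: leq_ltn_trans K_gt1; case: (a <= i).
- by move=> /leq_trans; apply.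
- by rewrite regK.
by rewrite regK.
Qed.

Lemma net_edges_copy l x l1 : (l, x, l1) \in net_edges -> kind x = 0 -> l1 = l.
Proof.
by case/net_edgesP => [i _ _ ->|/graph_letter[_]|j _ _ ->|j _ _ ->]; rewrite ?kindK //; case: kind.
Qed.

Lemma net_edges_dec l j i l1 : (l, dec j, l1) \in net_edges -> i < K ->
  (l, cpy i, l) \in net_edges.
Proof.
move=> eE lt_i; rewrite mem_net_edges; apply/or4P; constructor 3.
apply/allpairsPdep; exists l, i; rewrite !mem_iota lt_i; split=> //=.
case/net_edgesP: eE => [i' _ _ /(congr1 kind)|/graph_src|j' _ _ /(congr1 kind)|j' _ -> _ _] //.
- by rewrite !kindK.
- by case=> [->|[]]; lia.
Qed.

Lemma net_edges_final x l1 : (0, x, l1) \in net_edges -> l1 = 0.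
Proof.
case/net_edgesP => [//|/graph_src[|[]]|j _ _ _|j _ _ _] //; lia.
Qed.

(** Loader edges leave odd locations from 3 on, edges of the graph leave 1 or an even location;
    location 0, with its drains, is excluded. *)
Lemma net_edges_det l x1 l1 x2 l2 : l <> 0 -> 0 < kind x1 -> 0 < kind x2 ->
  (l, x1, l1) \in net_edges -> (l, x2, l2) \in net_edges ->
  compat (x1, l1) (x2, l2).
Proof.
move=> l0 k1 k2 /net_edgesP[i1 _ E1 -> ->|e1|j _ _ E1|j _ E1 _ _]; last 2 first.
- by rewrite E1 kindK in k1.
- by rewrite E1 in l0.
- case/net_edgesP => [i2 _ E2 -> ->|/graph_src e2|j _ _ E2 _|j _ E2 _ _].
  + by left; have -> : i1 = i2 by lia.
  + by lia.
  + by rewrite E2 kindK in k2.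
  by lia.
case/net_edgesP => [i2 _ E2 -> ->|e2|j _ _ E2 _|j _ E2 _ _].
- by have := graph_src e1; lia.
- exact: graph_det e1 e2.
- by rewrite E2 kindK in k2.
by lia.
Qed.

Lemma net_edges_functional l x l1 l2 :
  (l, x, l1) \in net_edges -> (l, x, l2) \in net_edges -> l1 = l2.
Proof.
move=> e1 e2; have [k0|k_gt0] := posnP (kind x).
  by rewrite (net_edges_copy e1 k0) (net_edges_copy e2 k0).
case: l => [|l] in e1 e2 *; first by rewrite (net_edges_final e1) (net_edges_final e2).
case: (net_edges_det _ k_gt0 k_gt0 e1 e2) => [//|[]//|[r /= [][->]]];
  by move=> /(congr1 kind); rewrite !kindK.
Qed.

Lemma net_edges_bound k : 1 < K -> regs p <= K -> 4 * K <= k -> (fresh p).+2 <= entry ->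
  forall e, e \in net_edges -> [/\ e.1.1 <= entry, e.1.2 <= k & e.2 <= entry].
Proof.
move=> K_gt1 regs_p le_k le_N [[l x] l1] eE /=.
have lt_x : x <= k.
  by have := net_edges_reg K_gt1 regs_p eE; rewrite /reg; lia.
rewrite lt_x; case/net_edgesP: eE => [i|e|j|j]; rewrite /entry in le_N *.
- by move=> *; split=> //; lia.
- by move: (graph_src e) => sE; case: (graph_dst e) => dE; split=> //; lia.
- by move=> *; split=> //; lia.
by move=> *; split=> //; lia.
Qed.

Lemma loader_reach :
  reach net_edges (entry, fun=> 0) (1, upd (upd (fun=> 0) 0 a) 1 b).
Proof.
(* The contents of the registers at location [i.*2.+1]. *)
pose v i : nat -> nat := upd (upd (fun=> 0) 0 (a - i)) 1 (b - (i - a)).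
have -> : upd (upd (fun=> 0) 0 a) 1 b = v 0 by rewrite /v subn0 sub0n subn0.
have -> : (fun=> 0) = v (a + b).
  by apply/funext => r; rewrite /v; upd_tac.
rewrite /entry; elim: {1 3 4}(a + b) (leqnn (a + b)) => [|i IHi] lt_i.
  exact: ReachRefl.
apply: ReachStep (IHi (ltnW lt_i)).
have -> : v i = upd (v i.+1) (a <= i) (v i.+1 (a <= i)).+1.
  by apply/funext => r; rewrite /v; case: (leqP a i) => ?; upd_tac.
apply: StepInc; rewrite mem_net_edges; apply/orP; left; apply/mapP; exists i => //.
by rewrite mem_iota.
Qed.

Lemma drain_reach v : (forall r, K <= r -> v r = 0) ->
  reach net_edges (0, v) (0, fun=> 0).
Proof.
move=> vK; pose st i : nat -> nat := fun r => if r < i then 0 else v r.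
have -> : (fun=> 0) = st K by apply/funext => r; rewrite /st; case: ltnP => // /vK.
have {1}-> : v = st 0 by [].
elim: {1 3}K (leqnn K) => [|i IHi] lt_i; first exact: ReachRefl.
apply: reach_trans (IHi (ltnW lt_i)) _.
have -> : st i = upd (st i) i (v i).
  by apply/funext => r; rewrite /upd /st; case: eqP => [->|//]; rewrite ltnn.
have -> : st i.+1 = upd (st i) i 0.
  by apply/funext => r; rewrite /st /upd ltnS leq_eqVlt; case: eqP.
elim: (v i) => [|m IHm]; first exact: ReachRefl.
apply: ReachStep IHm.
have -> : upd (st i) i m = upd (upd (st i) i m.+1) i (upd (st i) i m.+1 i).-1.
  by apply/funext => r; upd_tac.
apply: StepDec; last by rewrite /upd eqxx.
by rewrite mem_net_edges; apply/or4P; constructor 4; apply: map_f; rewrite mem_iota.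
Qed.

End NetEdges.

(** * Inclusion and reachability *)

Section Instance.
Variables (R : realType) (p : prog) (K a b k M : nat).
Hypotheses (K_gt1 : 1 < K) (regs_p : regs p <= K) (le_Kk : 4 * K <= k)
  (le_KM : K.*2.+2 <= M) (le_pN : (fresh p).+2 <= entry a b).

Let E := net_edges p K a b.
Let A := net k (entry a b) E.
Let B := monitor k M (patterns K).
Let ltE := net_edges_bound K_gt1 regs_p le_Kk le_pN.

Lemma patterns_bound s x g z d : (s, x, g, z, d) \in patterns K ->
  [/\ s <= M, x <= k & d <= M].
Proof.
rewrite mem_patterns => /and5P[_ lt_s lt_x lt_d _].
by split; [apply: leq_trans le_KM | apply: leq_trans (ltnW lt_x) _ | apply: leq_trans le_KM].
Qed.

Lemma net_run_letters (R' : realType) l m (w : seq (nat * R')) l' :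
  net_run E l m (unzip1 w) l' -> letters_lt K w.
Proof.
elim: w l m => [//|[x t] w IHw] l m /= [l1 [m1 [/(net_edges_reg K_gt1 regs_p) + _ /IHw->]]].
by rewrite andbT /reg ltn_divLR // mulnC.
Qed.

Lemma monitor_language (w : seq ('I_k.+1 * R)) : letters_lt K (erase w) ->
  language R B w <-> timed_word w /\ ~~ good (erase w).
Proof.
move=> wK; rewrite languageP; split=> -[tw].
  move=> [s [s' [[l /= + ->] rw s'a]]]; rewrite finset.in_set1 => /eqP lE; split=> //.
  have := timed_run_monitor patterns_bound rw; rewrite /= ffunE subr0 lE => mr.
  apply/(accepts_bad 0%R wK); exists s'.1.1; split=> //.
  by move: s'a; rewrite finset.inE.
move=> /(accepts_bad 0%R wK)[l' [oddl' mr]]; split=> //.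
have pw : path <=%R 0%R (unzip2 w).
  by have [_ w0 sw] := tw; rewrite path_min_sorted.
have mr0 : monitor_run (patterns K) (ord0 : 'I_M.+1)
    (0 - ([ffun=> 0] : {ffun 'I_1 -> R}) ord0)%R (erase w) l'.
  by rewrite ffunE subr0.
have [s' [rs' s'l]] := monitor_timed_run patterns_bound 0 pw mr0.
exists (ord0, [ffun=> 0%R], 0), s'; split=> //.
  by exists ord0 => //; rewrite /= finset.in_set1.
by rewrite finset.inE s'l.
Qed.

(** The words of [A] missing from [B] are the good ones, which encode runs of the program to
    location 0 with empty registers; [net_run_reach] and [reach_completes] give the two
    directions. *)
Lemma inclusion_reach :
  ~ (language R A `<=` language R B)%classic <->
  reach E (entry a b, fun=> 0) (0, fun=> 0).
Proof.
split=> [/existsNP[w /not_implyP[]]|rE incl].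
  move=> /languageP[tw [s [s' [[l /= + ->] rw s'a]]]] nB.
  rewrite finset.in_set1 => /eqP lE; rewrite lE in rw.
  have nr := timed_run_net ltE rw; rewrite finset.in_set1 in s'a.
  rewrite (eqP s'a) /= in nr.
  have wK := net_run_letters nr.
  have gw : good (erase w) by apply/negP => /negP gw; apply: nB; apply/monitor_language.
  (* The first event may occur at time 0, so the strictly increasing path starts from [-1]. *)
  have pw : path <%R (-1)%R (unzip2 (erase w)).
    have [_ w0 sw] := tw; apply: good_path => //.
      rewrite unzip2_erase path_min_sorted //; apply: sub_all w0 => t; apply: le_trans.
      by rewrite lerN10.
    case: (w) w0 => //= -[x t] w' /andP[/= t0 _].
    by rewrite gt_eqF // (lt_le_trans _ t0) // ltrN10.
  have [//|//|//|_ rr] := net_run_reach (q := [::]) (@net_edges_copy p K a b) pw gw _ _ _ nr.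
  exact: rr.
have := reach_completes (R := R) (fun l x l1 => net_edges_reg K_gt1 regs_p) (@net_edges_dec p K a b) rE erefl
  (q := [::]) (T := 0%R) erefl isT isT.
move=> [w [nr pw gw _]].
have wK := net_run_letters nr.
pose w' : seq ('I_k.+1 * R) := [seq (inord e.1, e.2) | e <- w].
have w'E : erase w' = w.
  rewrite /erase -map_comp -[RHS]map_id; apply/eq_in_map => -[x t] /(allP wK) /= ltx.
  by rewrite inordK // ltnS; apply: leq_trans le_Kk; apply: ltnW.
rewrite -{}w'E in nr pw gw wK; have w'0 := path_lt_all pw.
rewrite unzip2_erase in pw.
have tw' : timed_word w'.
  split.
  - by case: (w') nr.
  - by rewrite -unzip2_erase all_map; apply: sub_all w'0 => e /= /ltW.
  by move/path_sorted: pw; apply: sub_sorted => x y /ltW.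
suff /incl /(monitor_language wK)[_] : language R A w' by rewrite gw.
apply/languageP; split=> //.
have pw' : path <=%R 0%R (unzip2 w') by apply: sub_path pw => x y /ltW.
have [s' [rs' s'l]] := net_timed_run ltE (l := ord_max) [ffun=> 0%R] pw' nr.
exists (ord_max, [ffun=> 0%R], 0), s'; split=> //.
  by exists ord_max => //; rewrite /= finset.in_set1.
by rewrite finset.in_set1; apply/eqP/val_inj.
Qed.

(** The letter determines the counter operation, which gives the partition of the alphabet; location
    and letter determine the edge. *)
Lemma net_class : [/\ one_counter_net A, visibly A & deterministic A].
Proof.
split.
- by move=> e /(mem_net ltE)[l [x [l1 [_ -> _ _ _]]]] /=; rewrite /letter_op; case: kind => [|[|[]]].
- exists [set x : 'I_k.+1 | letter_op x == Noop]%SET, [set x : 'I_k.+1 | letter_op x == Push]%SET,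
    [set x : 'I_k.+1 | letter_op x == Pop]%SET; split.
  + by apply/setP => x; rewrite !finset.inE /letter_op; case: kind => [|[|[]]].
  + by split; apply/pred0P => x /=; rewrite !finset.inE /letter_op; case: kind => [|[|[]]].
  move=> e /(mem_net ltE)[l [x [l1 [_ -> _ + _]]]] /= => xE; rewrite !finset.inE xE.
  rewrite /letter_op; case: kind => [|[|[]]]; do !split=> //; try (by left); by case.
move=> l x o1 o2 l1 l2 /= /(mem_net ltE)[l' [x' [l1' [e1 E1 /= s1 b1 d1]]]].
move=> /(mem_net ltE)[l'' [x'' [l2' [e2 E2 /= s2 b2 d2]]]].
have lE : l'' = l' by rewrite -s2 -s1.
have xE : x'' = x' by rewrite -b2 -b1.
rewrite lE xE in e2 E2; rewrite E1 E2.
by rewrite (net_edges_functional e1 e2).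
Qed.

Lemma monitor_class : timed_automaton B.
Proof. by move=> e /mapP[[[[[s x] g] z] d] _ ->]. Qed.

End Instance.

(** * Codes and diagonalization *)

Definition pair_code x y := CodeSeq.code [:: x; y].

Lemma computable_pair n f g :
  computable n f -> computable n g -> computable n (fun s => pair_code (f s) (g s)).
Proof.
move=> fP gP; apply: computable_code_cons => //.
exact/computable_code_cons/computable_const.
Qed.

Lemma ltn_pair_code x y : x < pair_code x y.
Proof. by have /andP[] := CodeSeq.ltn_code [:: x; y]. Qed.

(** The code of [net_edge e]; the zeros are the codes of the guard [[::]] and of the empty reset
    set. *)
Definition edge_code (e : nat * nat * nat) :=
  pair_code (pair_code (pair_code (pair_code (pair_code e.1.1 e.1.2) 0)
    (op_ord (letter_op e.1.2))) 0) e.2.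

Definition singleton_code n x :=
  CodeSeq.code (mkseq (fun i => pair_code i (i == x)) n).

(** A finite set is stored as its characteristic function, coded as the list of its pairs of
    argument and value. *)
Lemma pickle_set n (S : {set 'I_n}) :
  pickle S = CodeSeq.code [seq pair_code i (i \in S) | i : 'I_n <- enum 'I_n].
Proof.
transitivity (pickle (tfgraph (finset.finfun_of_set S))); first by [].
transitivity (CodeSeq.code (map pickle (tfgraph (finset.finfun_of_set S)))); first by [].
rewrite -codom_tffun codomE -map_comp; congr CodeSeq.code; apply: eq_map => i /=.
rewrite unlock /pair_code /=; congr (CodeSeq.code [:: _; _]).
Qed.

Lemma pickle_set0 : pickle (finset.set0 : {set 'I_0}) = 0.
Proof. by rewrite pickle_set (_ : enum 'I_0 = [::]) //; apply: size0nil; rewrite size_enum_ord. Qed.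

Lemma pickle_set1 n (x : 'I_n) : pickle (finset.set1 x) = singleton_code n x.
Proof.
rewrite pickle_set /singleton_code /mkseq -val_enum_ord -map_comp; congr CodeSeq.code.
by apply: eq_map => i /=; rewrite finset.in_set1.
Qed.

Lemma pickle_edge k n c (e : edge 'I_k 'I_n 'I_c) : pickle e =
  pair_code (pair_code (pair_code (pair_code (pair_code (src e) (lbl e)) (pickle (guard e)))
    (op_ord (cop e))) (pickle (reset e))) (dst e).
Proof. by []. Qed.

Lemma pickle_automaton k n c (A : toca 'I_k 'I_n 'I_c) : pickle (Automaton A) =
  pair_code n (pair_code c (pair_code (pair_code (pickle (initial A)) (pickle (accepting A)))
    (CodeSeq.code (map pickle (edges A))))).
Proof. by []. Qed.

Definition net_code N c := pair_code N.+1 (pair_code 0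
  (pair_code (pair_code (singleton_code N.+1 N) (singleton_code N.+1 0)) c)).

Lemma pickle_net k N E :
  (forall e, e \in E -> [/\ e.1.1 <= N, e.1.2 <= k & e.2 <= N]) ->
  pickle (Automaton (net k N E)) = net_code N (CodeSeq.code (map edge_code E)).
Proof.
move=> ltE; rewrite pickle_automaton /= !pickle_set1 /net_code -map_comp.
congr (pair_code _ (pair_code _ (pair_code _ (CodeSeq.code _)))).
apply/eq_in_map => -[[l x] l1] /ltE[/= lN xk l1N].
by rewrite pickle_edge /= pickle_set0 !inordK.
Qed.

(** Letters are coded as plain numbers, whatever the alphabet. This allows [b] to be the code of the
    monitor and also to fix the alphabet. *)
Lemma pickle_monitor k k' M F :
  (forall s a g z d, (s, a, g, z, d) \in F -> [/\ s <= M, a <= k & d <= M]) ->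
  k <= k' -> pickle (Automaton (monitor k M F)) = pickle (Automaton (monitor k' M F)).
Proof.
move=> ltF le_k; rewrite !pickle_automaton /= -!map_comp.
congr (pair_code _ (pair_code _ (pair_code _ (CodeSeq.code _)))).
apply/eq_in_map => -[[[[s x] g] z] d] /ltF[lN xk l1N].
by rewrite /= !pickle_edge /= !inordK // ltnS (leq_trans xk).
Qed.

Lemma pickle_instance k (A B : automaton k) :
  pickle (InclusionInstance A B) = pair_code k (pair_code (pickle A) (pickle B)).
Proof. by []. Qed.

Definition loaded_code a b c := foldr code_cons c (map edge_code (loader a b)).

(** The alphabet must be computed from [a] and [b] alone, because [K] depends on the program that
    computes this function; [b.+1] letters suffice since a code exceeds its entries. *)
Definition instance_code a b :=
  pair_code b.+1 (pair_code (net_code (entry a b) (loaded_code a b a)) b).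

Lemma computable_singleton n f g : computable n f -> computable n g ->
  computable n (fun s => singleton_code (f s) (g s)).
Proof.
move=> fP gP; apply: (computable_code_mkseq (h := fun i s => pair_code i (i == g s)) fP
  (computable_const n 0)).
have headP : computable n.+2 (fun s => head 0 s).
  by apply: (eq_computable (h := nth 0 ^~ 0)) => [s _|]; [exact: nth0 | exact: computable_proj].
by apply: computable_pair => //; apply: computable_eq => //; exact: computable_shift2.
Qed.

Lemma computable_instance : computable 2 (fun s => instance_code (nth 0 s 0) (nth 0 s 1)).
Proof.
have aP : computable 2 (fun s => nth 0 s 0) by exact: computable_proj.
have bP : computable 2 (fun s => nth 0 s 1) by exact: computable_proj.
have abP := computable_add aP bP.
have NP : computable 2 (fun s => entry (nth 0 s 0) (nth 0 s 1)).
  by apply: eq_computable (computable_succ (computable_add abP abP)) => s _; rewrite addnn.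
have c0 m := computable_const m 0.
apply: computable_pair; first exact: computable_succ.
apply: computable_pair => //; apply: computable_pair; first exact: computable_succ.
apply: computable_pair => //; apply: computable_pair.
  by apply: computable_pair; apply: computable_singleton => //; exact: computable_succ.
(* The codes of the loader edges in arithmetic form: a truncated difference expresses [a <= i], and
   the middle zero is the number of [Push]. *)
apply: (eq_computable (h := fun s => foldr code_cons (nth 0 s 0) (mkseq (fun i =>
    pair_code (pair_code (pair_code (pair_code (pair_code (i + i).+3
      (4 * (nth 0 s 0 - i == 0)).+1) 0) 0) 0) (i + i).+1) (nth 0 s 0 + nth 0 s 1)))).
  move=> s _; rewrite /loaded_code /loader -map_comp; congr (foldr _ _ _).
  apply: eq_map => i; rewrite /= /edge_code /= /letter_op kindK /inc !addnn.
  by rewrite subn_eq0.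
apply: (computable_code_mkseq (h := fun i s => pair_code (pair_code (pair_code (pair_code
  (pair_code (i + i).+3 (4 * (nth 0 s 0 - i == 0)).+1) 0) 0) 0) (i + i).+1) abP aP).
have headP : computable 4 (fun s => head 0 s).
  by apply: (eq_computable (h := nth 0 ^~ 0)) => [s _|]; [exact: nth0 | exact: computable_proj].
have iP := computable_add headP headP.
do 5?[apply: computable_pair => //]; try exact: computable_succ.
  by do 3?apply: computable_succ.
apply/computable_succ/computable_mul; first exact: computable_const.
apply: computable_eq => //; apply: computable_sub => //; exact: computable_shift2 aP.
Qed.

(** * The diagonal argument *)

Local Open Scope classical_set_scope.

Lemma restricted_inclusion_undecidable (R : realType) :
  ~ decidable_problem
      (fun I : inclusion_instance =>
         [/\ one_counter_net (left_aut I), visibly (left_aut I)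
           & timed_automaton (right_aut I)] /\
         [/\ deterministic (left_aut I), nclk (left_aut I) = 0
           & (nclk (right_aut I) <= 1)%N])
      (fun I : inclusion_instance =>
         language R (left_aut I) `<=` language R (right_aut I)).
Proof.
case=> f fP; have [e eP] := computable_instance.
(* The inputs are in registers 0 and 1, the answer goes to register 2, and scratch starts at 3. The
   final decrement blocks on the answer 0, so [p] halts only on yes. *)
pose q := compile (Comp f (fun=> e)) id 2 3; pose p := Seq q (Dec 2).
have [K defK] : exists K, K = regs p by exists (regs p).
(* Being the code of an automaton with [M.+1] locations, [b] exceeds [M], hence both [4 * K] and the
   size of the control graph. *)
have [M defM] : exists M, M = 4 * K + (fresh p).+2 by eexists.
have [a defa] : exists a, a = CodeSeq.code (map edge_code (template p K)) by eexists.
have [b defb] : exists b, b = pickle (Automaton (monitor (4 * K) M (patterns K))).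
  by eexists.
have K_gt2 : 2 < K by rewrite defK /= leq_max leqnn orbT.
have K_gt1 := ltnW K_gt2; have le_pK : regs p <= K by rewrite defK.
have lt_Mb : M < b by rewrite defb pickle_automaton; apply/ltnW/ltn_pair_code.
have le_Kb : 4 * K <= b by lia.
have le_KM : K.*2.+2 <= M by lia.
have le_pN : (fresh p).+2 <= entry a b by rewrite /entry; lia.
have ltE := net_edges_bound K_gt1 le_pK le_Kb le_pN.
pose A := net b (entry a b) (net_edges p K a b); pose B := monitor b M (patterns K).
pose I := InclusionInstance (Automaton A) (Automaton B).
(* The self-reference: on input [a], [b] the program asks about the instance built from itself. *)
have IE : pickle I = instance_code a b.
  rewrite pickle_instance (pickle_net ltE) -(pickle_monitor _ le_Kb).
    by rewrite /instance_code /net_edges map_cat code_cat -defb -defa.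
  exact: (patterns_bound (leqnn _) le_KM).
have [cl1 cl2 cl3] := net_class K_gt1 le_pK le_Kb le_pN.
have cl4 := @monitor_class K b M.
have [|bb [evf bbP]] := fP I; first by split.
pose v0 := upd (upd (fun=> 0) 0 a) 1 b.
have qP : runs q v0 (upd v0 2 bb).
  apply: (runs_compile (x := [tuple a; b])) => //=.
  - exists [tuple instance_code a b]; split; last by rewrite -IE.
    by move=> i; rewrite ord1 /= tnth0; apply: eP.
  - by case=> [|[|]].
  - by case=> [|[|]].
  by case=> [|[|]].
have loadP := @loader_reach p K a b.
have equiv := inclusion_reach R K_gt1 le_pK le_Kb le_KM le_pN.
case: bb bbP qP {evf} => -[bbP1 bbP2] qP.
  (* Answer yes: the program passes its final decrement and halts, so the inclusion fails. *)
  apply: equiv.2 (bbP1 isT); apply: reach_trans loadP _.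
  apply: (reach_trans (c2 := (0, upd (upd v0 2 1) 2 0))).
    apply: sub_reach (@graph_net_edges p K a b) _.
    by apply: runs_seq qP _ 1 0 2; exact: runs_dec.
  by apply: drain_reach => r le_Kr; rewrite /v0 /upd !ifF //; lia.
(* Answer no: the inclusion fails, so location 0 is reachable; but the run of [p] blocks at location
   2. *)
have finalP : reach (net_edges p K a b) (entry a b, fun=> 0) (0, fun=> 0).
  by apply/equiv => /bbP2.
apply: (reach_stuck (E := net_edges p K a b) (f := 0) _ _ (c1 := (2, upd v0 2 0)) _ finalP) => //.
- exact: net_edges_det.
- exact: net_edges_final.
- apply: reach_trans loadP _; apply: sub_reach (@graph_net_edges p K a b) _.
  apply: (sub_reach (E := graph q 1 2 4)) => [x xE|]; first by rewrite mem_cat xE.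
  exact: qP.
(* Apart from copies, only the decrement of register 2 leaves location 2, and that register is 0. *)
move=> c' /step_edge[x [l [xE kx /(_ 2) decP]]].
case/net_edgesP: xE kx decP => [//||j _ _ ->|//]; last by rewrite kindK.
rewrite -[graph p 1 0 2]/(graph q 1 2 4 ++ [:: (2, dec 2, 0)]) mem_cat inE.
by case/orP=> [/graph_src[//|[]]|/eqP[-> _] _ /(_ erefl)] //=; lia.
Qed.

Theorem theorem3p1 (R : realType) :
  ~ decidable_problem
      (fun I : inclusion_instance =>
         [/\ one_counter_net (left_aut I), visibly (left_aut I)
           & timed_automaton (right_aut I)])
      (fun I : inclusion_instance =>
         language R (left_aut I) `<=` language R (right_aut I))
  /\
  ~ decidable_problem
      (fun I : inclusion_instance =>
         [/\ one_counter_net (left_aut I), visibly (left_aut I)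
           & timed_automaton (right_aut I)] /\
         [/\ deterministic (left_aut I), nclk (left_aut I) = 0
           & (nclk (right_aut I) <= 1)%N])
      (fun I : inclusion_instance =>
         language R (left_aut I) `<=` language R (right_aut I)).
Proof.
have undec := @restricted_inclusion_undecidable R.
(* A procedure for all instances also decides the restricted ones. *)
by split=> // -[f fP]; apply: undec; exists f => I [DI _]; apply: fP.
Qed.
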